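(* Let $n,N\in\mathbb N$, $\mathcal G=(\mathbb H^n)^N$, let $d\in C^\infty(\mathcal G\setminus\{0\})$ be a homogeneous norm, and fix $p\ge2$, $\theta\in\mathbb R$. With \[ Z_d=\frac{n+1}{n}\,\frac{z}{d}-\frac{p\theta}{2n}\,\frac{1}{d^2}\sum_{j=1}^Nt_j\,\nabla^{(j)\perp}d, \] every $u\in C_c^\infty(\mathcal G\setminus\{0\})$ satisfies \[ \int_{\mathcal G}\frac{|\langle\nabla_{\mathcal G}u,Z_d\rangle|^p}{d^{p(\theta-1)}}\,dz\,dt\ge\left|\frac{Q-p\theta}{p}\right|^p\int_{\mathcal G}\frac{|u|^p}{d^{p\theta}}\,dz\,dt . \]
   Context: $\mathcal G=(\mathbb H^n)^N$ is $\mathbb R^{2nN}\times\mathbb R^N$ with coordinates $z=(z^{(1)},\dots,z^{(N)})$, $z^{(j)}\in\mathbb R^{2n}$, $t=(t_1,\dots,t_N)$; group law $(z,t)\circ(\eta,\tau)=(z+\eta,t+\tau+\tfrac12(\langle B_{\mathbb H}z^{(1)},\eta^{(1)}\rangle,\dots,\langle B_{\mathbb H}z^{(N)},\eta^{(N)}\rangle))$ with $B_{\mathbb H}=\mathrm{diag}\left(\begin{pmatrix}0&4\\-4&0\end{pmatrix},\dots\right)\in\mathbb R^{2n\times2n}$; dilations $\delta_\gamma(z,t)=(\gamma z,\gamma^2t)$; $Q=2N(n+1)$. Horizontal fields $X^{(j)}_{2i-1}=\partial_{z^{(j)}_{2i-1}}+2z^{(j)}_{2i}\partial_{t_j}$,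 $X^{(j)}_{2i}=\partial_{z^{(j)}_{2i}}-2z^{(j)}_{2i-1}\partial_{t_j}$; $\nabla_{\mathcal G}$ is the vector of all of them; horizontal vector fields are identified with $\mathbb R^{2nN}$-valued functions via this basis. $\nabla^{(j)\perp}d$ has components $(-X^{(j)}_2d,X^{(j)}_1d,\dots,-X^{(j)}_{2n}d,X^{(j)}_{2n-1}d)$ in the $j$-th block and zero elsewhere. A homogeneous norm is a continuous $d\ge0$ with $d(\delta_\lambda(z,t))=\lambda d(z,t)$, $d>0$ off the origin, and satisfying the triangle inequality $d((z,t)\circ(\eta,\tau))\le d(z,t)+d(\eta,\tau)$. *)

(* Defs.v *)
From HB Require Import structures.
From mathcomp Require Import all_boot all_order all_algebra.
From mathcomp Require Import all_classical all_reals all_analysis.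
Set Implicit Arguments. Unset Strict Implicit. Unset Printing Implicit Defensive.
Import Order.TTheory GRing.Theory Num.Theory.
Import numFieldNormedType.Exports.
Local Open Scope classical_set_scope.
Local Open Scope ring_scope.

(* The group G = (H^n)^N.  A point is a pair (z, t) with
   z : 'M_(N, 2n)  (row j = z^(j) in R^{2n}, entries 0-indexed) and
   t : 'rV_N       (t 0 j = t_j).                                          *)
Definition GPt (R : realType) (n N : nat) := ('M[R]_(N, 2 * n) * 'rV[R]_N)%type.

(* The matrix B_H = diag([[0,4],[-4,0]], ...) in R^{2n x 2n}, 0-indexed:
   B a (a+1) = 4 for a even, B a (a-1) = -4 for a odd, 0 elsewhere.       *)
Definition BH (R : realType) (n : nat) : 'M[R]_(2 * n) :=
  \matrix_(a, b) (if ~~ odd a && (b == a.+1 :> nat) then 4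
                  else if odd a && (b.+1 == a :> nat) then -4 else 0).

Definition Bpair (R : realType) (n : nat) (x y : 'rV[R]_(2 * n)) : R :=
  \sum_(a < 2 * n) \sum_(b < 2 * n) BH R n a b * x 0 b * y 0 a.

Definition gmul (R : realType) (n N : nat) (p q : GPt R n N) : GPt R n N :=
  (p.1 + q.1,
   p.2 + q.2 + \row_(j < N) (2^-1 * Bpair (row j p.1) (row j q.1))).

Definition dil (R : realType) (n N : nat) (g : R) (p : GPt R n N) : GPt R n N :=
  (g *: p.1, (g ^+ 2) *: p.2).

Definition Qdim (n N : nat) : nat := 2 * N * (n + 1).

(* Horizontal field X^(j)_a (0-indexed a < 2n).  In 1-indexed notation
   X_{2i-1} = d_{z_{2i-1}} + 2 z_{2i} d_{t_j},  X_{2i} = d_{z_{2i}} - 2 z_{2i-1} d_{t_j};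
   the t-coefficient equals (1/2) (B_H z^(j))_a.  X u (x) is the directional
   derivative of u at x in the direction of this vector field at x.        *)
Definition Xdir (R : realType) (n N : nat) (j : 'I_N) (a : 'I_(2 * n))
  (x : GPt R n N) : GPt R n N :=
  (delta_mx j a,
   (2^-1 * \sum_(b < 2 * n) BH R n a b * x.1 j b) *: delta_mx 0 j).

Definition Xf (R : realType) (n N : nat) (j : 'I_N) (a : 'I_(2 * n))
  (u : GPt R n N -> R) (x : GPt R n N) : R :=
  'D_(Xdir j a x) u x.

Definition hgrad (R : realType) (n N : nat) (u : GPt R n N -> R)
  (x : GPt R n N) : 'M[R]_(N, 2 * n) :=
  \matrix_(j, a) Xf j a u x.

(* nabla^(j)perp d : components (-X_2 d, X_1 d, ..., -X_2n d, X_{2n-1} d)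
   in block j, zero elsewhere.  0-indexed: entry a even is -X_{a+1} d,
   entry a odd is X_{a-1} d.                                              *)
Definition perp_entry (R : realType) (n N : nat) (j : 'I_N) (d : GPt R n N -> R)
  (x : GPt R n N) (a : 'I_(2 * n)) : R :=
  \sum_(b < 2 * n)
     (if ~~ odd a && (b == a.+1 :> nat) then - Xf j b d x
      else if odd a && (b.+1 == a :> nat) then Xf j b d x else 0).

Definition hperp (R : realType) (n N : nat) (j : 'I_N) (d : GPt R n N -> R)
  (x : GPt R n N) : 'M[R]_(N, 2 * n) :=
  \matrix_(j', a) (if j' == j then perp_entry j d x a else 0).

Definition hdot (R : realType) (n N : nat) (A B : 'M[R]_(N, 2 * n)) : R :=
  \sum_(j < N) \sum_(a < 2 * n) A j a * B j a.

Definition Zd (R : realType) (n N : nat) (p theta : R) (d : GPt R n N -> R)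
  (x : GPt R n N) : 'M[R]_(N, 2 * n) :=
  ((n.+1%:R / n%:R) / d x) *: x.1
  - ((p * theta / (2 * n%:R)) / (d x ^+ 2)) *:
      \sum_(j < N) (x.2 0 j *: hperp j d x).

(* Smoothness: C^k on a set U (intended open), by induction on k:
   C^0 = continuous at every point of U;
   C^{k+1} = differentiable at every point of U and every directional
   derivative 'D_v f is C^k on U.  C^oo = C^k for all k.                 *)
Fixpoint Ck (R : realType) (V : normedModType R) (k : nat) (U : set V)
  (f : V -> R) : Prop :=
  match k with
  | 0 => forall x, U x -> {for x, continuous f}
  | k'.+1 => (forall x, U x -> differentiable f x) /\
             (forall v : V, Ck k' U ('D_v f))
  end.

Definition smooth_on (R : realType) (V : normedModType R) (U : set V)
  (f : V -> R) : Prop := forall k, Ck k U f.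

Definition Cc_inf (R : realType) (V : normedModType R) (U : set V)
  (u : V -> R) : Prop :=
  smooth_on U u /\
  exists K : set V, compact K /\ K `<=` U /\ (forall x, ~ K x -> u x = 0).

Definition hom_norm (R : realType) (n N : nat) (d : GPt R n N -> R) : Prop :=
  continuous d /\
  (forall x, 0 <= d x) /\
  (forall (g : R) x, 0 < g -> d (dil g x) = g * d x) /\
  (forall x, x != 0 -> 0 < d x) /\
  (forall x y, d (gmul x y) <= d x + d y).

(* Lebesgue integral over R^m of a nonnegative function, as the iterated
   one-dimensional Lebesgue integral (equal to the integral w.r.t. Lebesgue
   measure on R^m by Tonelli for nonnegative measurable integrands).     *)
Definition consv (R : realType) (m : nat) (x : R) (v : 'rV[R]_m) : 'rV[R]_m.+1 :=
  \row_(i < m.+1) (match unlift ord0 i with None => x | Some i' => v 0 i' end).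

Fixpoint intRn (R : realType) (m : nat) : ('rV[R]_m -> \bar R) -> \bar R :=
  match m return ('rV[R]_m -> \bar R) -> \bar R with
  | 0 => fun f => f 0
  | m'.+1 => fun f =>
      (\int[@lebesgue_measure R]_(x in [set: R]) intRn (fun v => f (consv x v)))%E
  end.

Definition intG (R : realType) (n N : nat) (f : GPt R n N -> \bar R) : \bar R :=
  intRn (fun zv : 'rV[R]_(N * (2 * n)) =>
           intRn (fun t : 'rV[R]_N => f (vec_mx zv, t))).

(* Main.v *)
Require Import Defs.
From HB Require Import structures.
From mathcomp Require Import all_boot all_order all_algebra.
From mathcomp Require Import all_classical all_reals all_analysis.
From mathcomp Require Import ring lra zify.
Import Order.TTheory GRing.Theory Num.Theory.
Import numFieldNormedType.Exports.
Local Open Scope classical_set_scope.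
Local Open Scope ring_scope.

(** Put [Y = d Z_d]. Homogeneity of [d] (Euler's identity) and the commutator
    [X_1, X_2] = -4 d_t give div_H (d^(-p theta) Y) = (Q - p theta) d^(-p theta),
    so G := div_H (|u|^p d^(-p theta) Y) equals
    p |u|^(p-2) u d^(-p theta) <grad u, Y> + (Q - p theta) |u|^p d^(-p theta).
    With a = |u| d^(-theta), b = |<grad u, Z_d>| d^(1 - theta) and
    lam = |Q - p theta| / p, the tangent-line inequality for x^p at lam a turns
    this into the pointwise bound lam^p a^p <= b^p + c G with a constant c.
    It remains to see that G has integral zero. The flow of a horizontal field
    X_{j,a} is x |-> x + s X_{j,a}(x), a shear that preserves the iterated
    integral by translation invariance in one variable at a time; hence the
    difference quotients of f along the flow have integral zero, and they converge
    uniformly to X_{j,a} f when f is C^1 with compact support. *)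

Set Implicit Arguments.
Unset Strict Implicit.
Unset Printing Implicit Defensive.

(** * Iterated integrals of uniformly continuous functions with bounded support *)

(** The radius [M] is a parameter because the bound in [csupp_functional] depends on it. Uniform
    continuity is a property that partial integrals inherit by a plain supremum estimate. *)
Definition ucsupp (R : realType) (V : normedModType R) (M : R) (f : V -> R) :=
  (forall e, 0 < e -> exists2 r, 0 < r &
     forall x y, `|x - y| < r -> `|f x - f y| < e) /\
  (forall x, M < `|x| -> f x = 0).

(* The only properties of the iterated integral that the proof uses; they pass
   to iterated functionals without measurability or Fubini arguments. *)
Definition csupp_functional (R : realType) (V : normedModType R)
    (E : (V -> \bar R) -> \bar R) (L : (V -> R) -> R) :=
  [/\ forall M f, ucsupp M f -> E (fun x => (f x)%:E) = (L f)%:E,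
      forall M a f g, ucsupp M f -> ucsupp M g ->
        L (fun x => a * f x + g x) = a * L f + L g,
      forall M f, ucsupp M f -> (forall x, 0 <= f x) -> 0 <= L f &
      forall M, exists2 C, 0 <= C & forall f e, ucsupp M f ->
        (forall x, `|f x| <= e) -> `|L f| <= C * e].

Section Ucc.
Variables (R : realType).
Implicit Types (V W U : normedModType R) (M : R).

Lemma ucsupp_continuous V M (f : V -> R) : ucsupp M f -> continuous f.
Proof.
move=> [fu _] x; apply/cvgrPdist_lt => e e0; have [r r0 hr] := fu e e0.
by apply/nbhs_ballP; exists r => //= y; rewrite -ball_normE; exact: hr.
Qed.

Lemma ucsupp_lin V M a (f g : V -> R) : ucsupp M f -> ucsupp M g ->
  ucsupp M (fun x => a * f x + g x).
Proof.
move=> [fu f0] [gu g0]; split; last by move=> x xM; rewrite f0// g0// mulr0 addr0.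
move=> e e0; have a0 : 0 < `|a| + 1 by rewrite ltr_wpDl.
have [r r0 hr] := fu (e / 2 / (`|a| + 1)) ltac:(by rewrite !divr_gt0).
have [s s0 hs] := gu (e / 2) ltac:(by rewrite !divr_gt0).
exists (Order.min r s); first by rewrite lt_min r0.
move=> x y; rewrite lt_min => /andP[/hr fxy /hs gxy].
rewrite (_ : _ - _ = a * (f x - f y) + (g x - g y)); last by ring.
apply: (le_lt_trans (ler_normD _ _)); rewrite normrM.
rewrite ltr_pdivlMr// in fxy.
have := normr_ge0 a; have := normr_ge0 (f x - f y).
nra.
Qed.

Lemma ucsupp_norm V M (f : V -> R) : ucsupp M f -> ucsupp M (fun x => `|f x|).
Proof.
move=> [fu f0]; split; last by move=> x xM; rewrite f0 // normr0.
move=> e e0; have [r r0 hr] := fu e e0; exists r => // x y /hr.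
by apply: le_lt_trans; exact: ler_dist_dist.
Qed.

Lemma ucsupp_le V M M' (f : V -> R) : M <= M' -> ucsupp M f -> ucsupp M' f.
Proof. by move=> MM' [fu f0]; split=> // x /(le_lt_trans MM'); exact: f0. Qed.

(** Meant for divergences, which are double sums of derivatives. Asking for all large [M] lets the
    summands share one radius. *)
Lemma csupp_functional_sum_eq0 V E L (I : Type) (r : seq I) (F : I -> V -> R) : csupp_functional E L ->
  (forall i, (exists M0, forall M, M0 <= M -> ucsupp M (F i)) /\ L (F i) = 0) ->
  (exists M0, forall M, M0 <= M -> ucsupp M (fun x => \sum_(i <- r) F i x)) /\
  L (fun x => \sum_(i <- r) F i x) = 0.
Proof.
move=> [_ lin _ _] FP.
have u0 M : ucsupp M (fun _ : V => 0 : R).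
  by split=> // e e0; exists 1 => // *; rewrite subrr normr0.
elim: r => [|i r [[M1 h1] e1]].
  have -> : (fun x => \sum_(i <- [::]) F i x) = (fun=> 0).
    by apply/funext => y; rewrite big_nil.
  split; first by exists 0.
  (* With [a = 1] and both functions zero, linearity reads [L 0 = L 0 + L 0]. *)
  have := lin 0 1 _ _ (u0 0) (u0 0).
  have -> : (fun _ : V => 1 * 0 + 0 : R) = (fun _ => 0).
    by apply/funext => y; rewrite mulr0 addr0.
  by move=> h; lra.
have [[M2 h2] e2] := FP i.
have -> : (fun x => \sum_(k <- i :: r) F k x)
    = (fun x => 1 * F i x + \sum_(k <- r) F k x).
  by apply/funext => x; rewrite big_cons mul1r.
split.
  exists (Num.max M1 M2) => M; rewrite ge_max => /andP[l1 l2].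
  by apply: ucsupp_lin; [exact: h2|exact: h1].
have g1 : ucsupp (Num.max M1 M2) (F i) by apply: h2; rewrite le_max lexx orbT.
have g2 : ucsupp (Num.max M1 M2) (fun x => \sum_(k <- r) F k x).
  by apply: h1; rewrite le_max lexx.
by rewrite (lin _ _ _ _ g1 g2) e1 e2 mulr0 addr0.
Qed.

(** [P] glues two groups of coordinates. A partial integral is uniformly continuous because [L2] of
    a difference is bounded by a constant times its supremum. The order of integration never
    changes, so each property of the composite follows from that of its two factors. *)
Lemma csupp_functional_iter V W U E1 L1 E2 L2 (P : V -> W -> U) :
  csupp_functional E1 L1 -> csupp_functional E2 L2 ->
  (forall x x' y y', `|P x y - P x' y'| <= Num.max `|x - x'| `|y - y'|) ->
  (forall x y, `|x| <= `|P x y|) -> (forall x y, `|y| <= `|P x y|) ->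
  (forall M (f : U -> R) x, ucsupp M f -> ucsupp M (fun y => f (P x y))) /\
  (forall M (f : U -> R), ucsupp M f -> ucsupp M (fun x => L2 (fun y => f (P x y)))) /\
  csupp_functional (fun f => E1 (fun x => E2 (fun y => f (P x y))))
       (fun f => L1 (fun x => L2 (fun y => f (P x y)))).
Proof.
move=> [e1 l1 p1 b1] g2 Pd Px Py.
have [e2 l2 p2 b2] := g2.
have sec M (f : U -> R) x : ucsupp M f -> ucsupp M (fun y => f (P x y)).
  move=> [fu f0]; split; last by move=> y yM; apply: f0; apply: lt_le_trans yM _.
  move=> e e0; have [r r0 hr] := fu e e0; exists r => // y y' yy'.
  by apply: hr; apply: (le_lt_trans (Pd _ _ _ _)); rewrite subrr normr0 gt_max r0.
have par M (f : U -> R) : ucsupp M f -> ucsupp M (fun x => L2 (fun y => f (P x y))).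
  move=> uf; have [fu f0] := uf; split.
    (* [C] may be 0, hence the division by [C + 1]. *)
    move=> e e0; have [C C0 hC] := b2 M.
    have C1 : 0 < C + 1 by rewrite ltr_wpDl.
    have [r r0 hr] := fu (e / (C + 1)) ltac:(by rewrite divr_gt0).
    exists r => // x x' xx'.
    rewrite (_ : _ - _ = -1 * L2 (fun y => f (P x' y)) + L2 (fun y => f (P x y)));
      last by ring.
    rewrite -(l2 M); [|exact: sec..].
    apply: (@le_lt_trans _ _ (C * (e / (C + 1)))); last first.
      rewrite mulrA ltr_pdivrMr// mulrC ltr_pM2l//; lra.
    apply: hC; first by apply: ucsupp_lin; exact: sec.
    move=> y; rewrite mulN1r addrC; apply/ltW/hr.
    by apply: (le_lt_trans (Pd _ _ _ _)); rewrite subrr normr0 gt_max r0 xx'.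
  move=> x xM.
  have -> : (fun y => f (P x y)) = (fun y => 0).
    by apply/funext => y; apply: f0; apply: lt_le_trans xM _.
  have u0 : ucsupp M (fun _ : W => 0 : R).
    by split=> // e e0; exists 1 => // *; rewrite subrr normr0.
  have := l2 M 1 _ _ u0 u0.
  have -> : (fun _ : W => 1 * 0 + 0 : R) = (fun _ => 0).
    by apply/funext => y; rewrite mulr0 addr0.
  by move=> h; lra.
split => //; split => //; split.
- move=> M f uf; rewrite -(e1 M); last exact: par.
  by congr E1; apply/funext => x; rewrite (e2 M)//; exact: sec.
- move=> M a f g uf ug; rewrite -(l1 M); [|exact: par..].
  by congr L1; apply/funext => x; rewrite (l2 M)//; exact: sec.
- move=> M f uf f_ge0; apply: (p1 M); first exact: par.
  by move=> x; apply: (p2 M) => //; exact: sec.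
- move=> M; have [C C0 hC] := b1 M; have [D D0 hD] := b2 M.
  exists (C * D); first exact: mulr_ge0.
  move=> f e uf fe; rewrite -mulrA; apply: hC; first exact: par.
  by move=> x; apply: hD => //; exact: sec.
Qed.

Lemma ucsupp_shift V M (f : V -> R) v : ucsupp M f -> ucsupp (M + `|v|) (fun x => f (x + v)).
Proof.
move=> [fu f0]; split=> [e /fu[r r0 hr]|x xM].
  by exists r => // x y xy; apply: hr; rewrite opprD addrACA subrr addr0.
by apply: f0; rewrite -ltrBrDr in xM; apply: (lt_le_trans xM); rewrite -[v]opprK normrN; apply: lerB_dist.
Qed.

Let mu := @lebesgue_measure R.

Lemma ucsupp_integrable M (f : R -> R) : ucsupp M f -> mu.-integrable setT (EFin \o f).
Proof.
move=> uf.
have -> : EFin \o f = (EFin \o f) \_ `[-M, M].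
  apply/funext => x; rewrite patchE; case: ifPn => //; rewrite notin_setE/= in_itv/= -ler_norml.
  by move=> /negP; rewrite -ltNge => xM; case: uf => _ /(_ _ xM) ->.
rewrite -integrable_mkcond//; apply: continuous_compact_integrable.
  exact: segment_compact.
exact/continuous_subspaceT/(ucsupp_continuous uf).
Qed.

Lemma csupp_functional_lebesgue :
  csupp_functional (fun f : R -> \bar R => (\int[mu]_(x in setT) f x)%E)
       (fun f : R -> R => \int[mu]_(x in setT) f x).
Proof.
split.
- move=> M f uf; rewrite /Rintegral fineK//.
  exact: integrable_fin_num (ucsupp_integrable uf).
- move=> M a f g uf ug; rewrite RintegralD//=.
  + by rewrite RintegralZl//; exact: ucsupp_integrable uf.
  + have /(integrableZl measurableT a) := ucsupp_integrable uf.
    by apply: eq_integrable => // x _; rewrite /= EFinM.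
  + exact: ucsupp_integrable ug.
- by move=> M f _ f0; apply: Rintegral_ge0.
(* This is the length of the interval from [-|M|] to [|M|]; the absolute value covers negative
   [M]. *)
- move=> M; exists (2 * `|M|); first by rewrite mulr_ge0.
  move=> f e uf fe; have e0 : 0 <= e by exact: le_trans (fe 0).
  have uM : ucsupp `|M| f by apply: ucsupp_le uf; exact: ler_norm.
  apply: (le_trans (le_normr_Rintegral _ (ucsupp_integrable uM))) => //.
  have -> : (fun x => `|f x|) = (fun x => `|f x|) \_ `[- `|M|, `|M|].
    apply/funext => x; rewrite patchE; case: ifPn => //; rewrite notin_setE/= in_itv/= -ler_norml.
    by move=> /negP; rewrite -ltNge => xM; case: uM => _ /(_ _ xM) ->; rewrite normr0.
  rewrite -Rintegral_mkcond.
  have -> : 2 * `|M| * e = \int[mu]_(x in `[- `|M|, `|M|]) (cst e) x.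
    rewrite Rintegral_cst//= lebesgue_measure_itv/= lte_fin.
    case: ifPn => [_|]; first by rewrite -EFinB/=; ring.
    rewrite -leNgt => h /=; have := normr_ge0 M => M0.
    have -> : `|M| = 0 by lra.
    ring.
  apply: le_Rintegral => //.
  + have /integrable_norm := ucsupp_integrable uM.
    exact: integrableS.
  + apply: continuous_compact_integrable; first exact: segment_compact.
    exact/continuous_subspaceT/cst_continuous.
Qed.

(** The substitution rule is applied to the nonnegative functions [|f|] and [f + |f|]; linearity
    then isolates [f]. *)
Lemma integral_shift M (f : R -> R) s : ucsupp M f ->
  (\int[mu]_(x in setT) (f (x + s))%:E = \int[mu]_(x in setT) (f x)%:E)%E.
Proof.
move=> uf.
have main (g : R -> R) : continuous g -> (forall x, 0 <= g x) ->
   (\int[mu]_(x in setT) (g (x + s))%:E = \int[mu]_(x in setT) (g x)%:E)%E.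
  move=> cg g0.
  have d1 (x : R) : is_derive x (1 : R) (fun x : R => x + s) (1 : R).
    by apply: is_derive_eq; rewrite addr0.
  have D1 : derive1 (fun x : R => x + s) = cst 1.
    by apply/funext => x; rewrite derive1E; apply: derive_val.
  rewrite (@increasing_ge0_integration_by_substitutionT _ (fun x => x + s) g) //.
  - by apply: eq_integral => x _ /=; rewrite D1 /= mulr1.
  - by move=> x y xy; rewrite ltrD2r.
  - by rewrite D1; exact: cst_continuous.
  - by rewrite D1; exact: is_cvg_cst.
  - by rewrite D1; exact: is_cvg_cst.
  - exact: cvg_addrr_Ny.
  - exact: cvg_addrr.
have un := ucsupp_norm uf.
have un1 := ucsupp_lin 1 uf un.
have us M' g : ucsupp M' g -> exists M'', ucsupp M'' (fun x : R => g (x + s)).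
  by move=> ug; exists (M' + `|s|); exact: ucsupp_shift.
have [E l _ _] := csupp_functional_lebesgue.
have [M1 uf1] := us _ _ uf; have [M2 un2] := us _ _ un; have [M3 un3] := us _ _ un1.
have H1 := main _ (ucsupp_continuous un) (fun=> normr_ge0 _).
have H2 : (\int[mu]_(x in setT) (1 * f (x + s) + `|f (x + s)|)%:E
   = \int[mu]_(x in setT) (1 * f x + `|f x|)%:E)%E.
  apply: (main (fun x => 1 * f x + `|f x|)); first exact: ucsupp_continuous un1.
  move=> x; rewrite mul1r; have := ler_norm (- f x); rewrite normrN; lra.
move: H1 H2.
rewrite (E _ _ un) (E _ _ un1) (E _ _ un2) (E _ _ un3) (E _ _ uf) (E _ _ uf1).
rewrite (l _ _ _ _ uf un).
rewrite (l (Num.max M1 M2) 1 (fun x => f (x + s)) (fun x => `|f (x + s)|)); first last.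
- by apply: ucsupp_le un2; rewrite le_max lexx orbT.
- by apply: ucsupp_le uf1; rewrite le_max lexx.
by move=> [->] [] /addIr; rewrite !mul1r => ->.
Qed.

End Ucc.

(** * Sup norms and the splitting of coordinates *)

Section MxNorm.
Variable R : realType.

Lemma mx_norm_le m n (A : 'M[R]_(m, n)) c : 0 <= c ->
  (forall i j, `|A i j| <= c) -> `|A| <= c.
Proof.
move=> c0 h; rewrite /Num.Def.normr/= mx_normrE.
by apply/bigmax_leP; split=> // -[i j] _ /=; exact: h.
Qed.

Lemma norm_coord_le m n (A : 'M[R]_(m, n)) i j : `|A i j| <= `|A|.
Proof.
rewrite [leRHS]/Num.Def.normr/= mx_normrE.
exact: (le_bigmax _ (fun k : 'I_m * 'I_n => `|A k.1 k.2|) (i, j)).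
Qed.

(** Together with [consv_head] and [consv_tail], this makes [consv] a gluing map for
    [csupp_functional_iter]. *)
Lemma consv_dist m x x' (v v' : 'rV[R]_m) :
  `|consv x v - consv x' v'| <= Num.max `|x - x'| `|v - v'|.
Proof.
apply: mx_norm_le => [|i j]; first by rewrite le_max normr_ge0.
rewrite !mxE; case: unliftP => [k _|_]; rewrite le_max ?lexx//.
by rewrite orbC; have := norm_coord_le (v - v') 0 k; rewrite !mxE => ->.
Qed.

Lemma consv_head m x (v : 'rV[R]_m) : `|x| <= `|consv x v|.
Proof. by have := norm_coord_le (consv x v) 0 ord0; rewrite mxE unlift_none. Qed.

Lemma consv_tail m x (v : 'rV[R]_m) : `|v| <= `|consv x v|.
Proof.
apply: mx_norm_le => // i j; have := norm_coord_le (consv x v) 0 (lift ord0 j).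
by rewrite mxE liftK ord1.
Qed.

Lemma vec_mx_norm m n (v : 'rV[R]_(m * n)) : `|vec_mx v| = `|v|.
Proof.
apply/eqP; rewrite eq_le; apply/andP; split; apply: mx_norm_le => // i j.
  by rewrite mxE; exact: norm_coord_le.
rewrite ord1; case/mxvec_indexP: j => i' j'.
by rewrite -[v]vec_mxK mxvecE vec_mxK; exact: norm_coord_le.
Qed.

End MxNorm.

(** * Translation invariance of the iterated integrals *)

Section IntRn.
Variable R : realType.

Lemma csupp_functional_intRn m : exists L, csupp_functional (@intRn R m) L.
Proof.
elim: m => [|m [L gL]].
  exists (fun f => f 0); split=> //= M; exists 1 => // f e _ /(_ 0).
  by rewrite mul1r.
have [_ [_ g]] := csupp_functional_iter (csupp_functional_lebesgue R) gL (@consv_dist R m)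
  (@consv_head R m) (@consv_tail R m).
by eexists; exact: g.
Qed.

(** Induction on the dimension: a shift of the first coordinate acts on the outer integral, any
    other shift acts under it. *)
Lemma intRn_shift1 m M (f : 'rV[R]_m -> R) i s : ucsupp M f ->
  intRn (fun v => (f (v + s *: delta_mx 0 i))%:E) = intRn (fun v => (f v)%:E).
Proof.
elim: m M f i => [|m IH] M f i uf; first by case: i.
have [L gL] := csupp_functional_intRn m.
have [sec [par _]] := csupp_functional_iter (csupp_functional_lebesgue R) gL (@consv_dist R m)
  (@consv_head R m) (@consv_tail R m).
have [eL _ _ _] := gL.
have [->|[j ->]] : i = ord0 \/ exists j, i = lift ord0 j.
  by case: (unliftP ord0 i) => [j|] ->; [right; exists j|left].
  rewrite /=.
  (* Written with [L], the inner integral is a real [ucsupp] function of [x], to which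
     [integral_shift] applies. *)
  transitivity (\int[lebesgue_measure]_x (L (fun v => f (consv (x + s) v)))%:E)%E.
    apply: eq_integral => x _; rewrite -(eL M); last exact: sec.
    congr intRn; apply/funext => v; congr (f _)%:E.
    by apply/rowP => k; rewrite !mxE; case: unliftP => [k' ->|->] /=;
      rewrite ?mulr1// mulr0 addr0.
  rewrite (integral_shift s (par _ _ uf)).
  by apply: eq_integral => x _; rewrite -(eL M)//; exact: sec.
rewrite /=; apply: eq_integral => x _; rewrite -(IH M _ j (sec _ _ x uf)).
congr intRn; apply/funext => v; congr (f _)%:E.
apply/rowP => k; rewrite !mxE; case: unliftP => [k' ->|->] /=.
  by rewrite !mxE (inj_eq (@lift_inj _ _)).
by rewrite mulr0 addr0.
Qed.

End IntRn.

Section IntG.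
Variables (R : realType) (n N : nat).
Notation G := (GPt R n N).

Let P (zv : 'rV[R]_(N * (2 * n))) (t : 'rV[R]_N) : G := (vec_mx zv, t).

Let Pd x x' y y' : `|P x y - P x' y'| <= Num.max `|x - x'| `|y - y'|.
Proof. by rewrite prod_normE/= -linearB vec_mx_norm. Qed.
Let P1 x y : `|x| <= `|P x y|.
Proof. by rewrite prod_normE/= vec_mx_norm le_max lexx. Qed.
Let P2 x y : `|y| <= `|P x y|.
Proof. by rewrite prod_normE/= le_max lexx orbT. Qed.

Lemma csupp_functional_intG : exists L, csupp_functional (@intG R n N) L.
Proof.
have [L1 g1] := csupp_functional_intRn R (N * (2 * n)); have [L2 g2] := csupp_functional_intRn R N.
have [_ [_ g]] := csupp_functional_iter g1 g2 Pd P1 P2.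
by eexists; exact: g.
Qed.

(* The shear preserves the iterated integral because it translates t by an
   amount depending only on z, and then translates z. *)
Lemma intG_shear M (f : G -> R) j a s (c : 'M[R]_(N, 2 * n) -> R) : ucsupp M f ->
  intG (fun x : G => (f (x.1 + s *: delta_mx j a, x.2 + c x.1 *: delta_mx 0 j))%:E)
  = intG (fun x => (f x)%:E).
Proof.
move=> uf; have [L1 g1] := csupp_functional_intRn R (N * (2 * n)); have [L2 g2] := csupp_functional_intRn R N.
have [sec [par _]] := csupp_functional_iter g1 g2 Pd P1 P2.
have [e2 _ _ _] := g2.
rewrite /intG/=.
(* Undoing the shift of [t] first eliminates [c]; what remains is a shift of the single coordinate
   of [zv] that holds entry [(j, a)]. *)
transitivity (intRn (fun zv : 'rV[R]_(N * (2 * n)) =>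
    (L2 (fun t => f (P (zv + s *: delta_mx 0 (mxvec_index j a)) t)))%:E)).
  congr intRn; apply/funext => zv.
  have -> : vec_mx zv + s *: delta_mx j a
      = vec_mx (zv + s *: delta_mx 0 (mxvec_index j a)).
    by rewrite linearD linearZ/= vec_mx_delta.
  by rewrite (intRn_shift1 j _ (sec _ _ _ uf)) (e2 M)//; exact: sec.
rewrite (intRn_shift1 _ _ (par _ _ uf)).
by congr intRn; apply/funext => zv; rewrite -(e2 M)//; exact: sec.
Qed.

End IntG.

(** * Integrals of derivatives along flows *)

Section Line.
Variables (R : realType) (V : normedModType R).

(** Both difference quotients are the same function of [h], so one-variable calculus transfers to
    directional derivatives. *)
Lemma is_derive_line (f : V -> R) x v (c df : R) :
  is_derive (x + c *: v) v f df <-> is_derive c (1 : R) (fun s : R => f (x + s *: v)) df.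
Proof.
have E : (fun h : R => h^-1 *: ((f \o shift (x + c *: v)) (h *: v) - f (x + c *: v)))
  = (fun h : R => h^-1 *: (((fun s : R => f (x + s *: v)) \o shift c) (h *: (1 : R))
                    - f (x + c *: v))).
  apply/funext => h /=; congr (_ *: (f _ - _)).
  rewrite (_ : h *: (1 : R) = h); last exact: mulr1.
  by rewrite scalerDl addrCA.
by split=> -[d e]; split; move: d e; rewrite /derivable /derive E.
Qed.

(** The one-variable chain rule on the line through [x], at parameter 0; this works from a single
    directional derivative of [f]. *)
Lemma is_derive_comp1 (f : V -> R) (g : R -> R) x v df dg :
  is_derive x v f df -> is_derive (f x) (1 : R) g dg ->
  is_derive x v (g \o f) (dg * df).
Proof.
move=> hf hg; rewrite -[x]addr0 -(scale0r v); apply/is_derive_line.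
rewrite -[x]addr0 -(scale0r v) in hf; move/is_derive_line in hf.
rewrite -[x in f x]addr0 -(scale0r v) in hg.
exact: (@is_derive1_comp R g (fun s : R => f (x + s *: v)) 0 dg df).
Qed.

Lemma MVT_line (f g : V -> R) x v (s : R) : 0 < s ->
  (forall c, 0 <= c <= s -> is_derive (x + c *: v) v f (g (x + c *: v))) ->
  exists2 c, 0 <= c <= s & f (x + s *: v) - f x = s * g (x + c *: v).
Proof.
move=> s0 h.
have hd c : 0 <= c <= s ->
    is_derive c (1 : R) (fun s : R => f (x + s *: v)) (g (x + c *: v)).
  by move=> hc; apply/is_derive_line/h.
have [] := @MVT_segment R (fun s : R => f (x + s *: v)) (fun c => g (x + c *: v)) 0 s (ltW s0).
- by move=> c; rewrite in_itv/= => /andP[c0 cs]; apply: hd; rewrite !ltW.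
- apply: derivable_within_continuous => c; rewrite in_itv/= => hc.
  by have [] := hd c hc.
- move=> c; rewrite in_itv/= => hc; rewrite scale0r addr0 subr0 mulrC => e.
  by exists c.
Qed.

(** Since [xi] is constant along its own lines, [x + s *: xi x] is its flow. The Lipschitz bound
    keeps [f] composed with the flow uniformly continuous. The field may be unbounded, but wherever
    it exceeds [B] the whole segment avoids the support. *)
Lemma integral_derive_eq0 (E : (V -> \bar R) -> \bar R) L M (xi : V -> V) C
    (f g : V -> R) : csupp_functional E L ->
  (forall x c, xi (x + c *: xi x) = xi x) ->
  (forall x y, `|xi x - xi y| <= C * `|x - y|) ->
  (exists B, forall x, `|xi x| <= B \/
     (forall c, 0 <= c <= 1 -> M < `|x + c *: xi x|)) ->
  (forall s, E (fun x => (f (x + s *: xi x))%:E) = E (fun x => (f x)%:E)) ->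
  ucsupp M f -> ucsupp M g -> (forall x, is_derive x (xi x) f (g x)) -> L g = 0.
Proof.
move=> [eL lin _ bnd] xiE lip [B hB] inv uf ug dfg.
wlog B0 : B hB / 0 < B.
  move=> w; apply: (w (Num.max B 1)); last by rewrite lt_max ltr01 orbT.
  by move=> x; case: (hB x) => h; [left; rewrite le_max h|right].
have M1 : M <= M + B by rewrite lerDl ltW.
(* Outside radius [M + B] the segment misses the ball of radius [M], so all [f (x + s *: xi x)] with
   [s] in [[0, 1]] share that radius. *)
have out x c : M + B < `|x| -> 0 <= c <= 1 -> M < `|x + c *: xi x|.
  move=> xM hc; case: (hB x) => [xB|]; last exact.
  rewrite -ltrBrDr in xM; apply: (lt_le_trans xM).
  apply: (@le_trans _ _ (`|x| - `|c *: xi x|)).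
    rewrite lerB// normrZ; case/andP: hc => c0 c1; rewrite ger0_norm//.
    by apply: le_trans xB; rewrite ler_piMl.
  by rewrite -[c *: xi x]opprK normrN; exact: lerB_dist.
have uf' : ucsupp (M + B) f by exact: ucsupp_le uf.
have ug' : ucsupp (M + B) g by exact: ucsupp_le ug.
have ufs s : 0 <= s <= 1 -> ucsupp (M + B) (fun x => f (x + s *: xi x)).
  move=> hs; have [fu f0] := uf; split; last by move=> x xM; apply/f0/out.
  move=> e e0; have [r r0 hr] := fu e e0.
  have C1 : 0 < `|C| + 1 by rewrite ltr_wpDl.
  have C2 : 0 < 1 + (`|C| + 1) by exact: addr_gt0.
  exists (r / (1 + (`|C| + 1))); first exact: divr_gt0.
  move=> x y; rewrite ltr_pdivlMr// => xy; apply: hr.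
  rewrite opprD addrACA -scalerBr; apply: le_lt_trans xy.
  apply: (le_trans (ler_normD _ _)); rewrite mulrDr mulr1 lerD2l normrZ.
  case/andP: hs => s0 s1; rewrite ger0_norm//.
  have := lip x y; have := normr_ge0 (xi x - xi y); have := normr_ge0 (x - y).
  have := ler_norm C; nra.
have [C' C'0 hC'] := bnd (M + B).
apply/eqP; rewrite -normr_le0; apply/ler_addgt0Pr => e e0; rewrite add0r.
have C'1 : 0 < C' + 1 by rewrite ltr_wpDl.
have [gu g0] := ug.
have [r r0 hr] := gu (e / (C' + 1)) ltac:(by rewrite divr_gt0).
(* [s <= 1] keeps the flow within the range of [out], and [s * B <= r / 2] keeps displacements below
   the modulus [r] of [g]. *)
pose s := Num.min 1 (r / (2 * B)).
have s0 : 0 < s by rewrite lt_min ltr01 divr_gt0// mulr_gt0.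
have s1 : s <= 1 by rewrite ge_min lexx.
have sB : s * B < r.
  have : s <= r / (2 * B) by rewrite ge_min lexx orbT.
  by rewrite ler_pdivlMr ?mulr_gt0// => h; lra.
have us := ufs s ltac:(by rewrite (ltW s0) s1).
have u1 := ucsupp_lin s^-1 uf' ug'.
have u2 := ucsupp_lin (- s^-1) us u1.
have Ls : L (fun x => f (x + s *: xi x)) = L f.
  by apply: EFin_inj; rewrite -(eL _ _ us) -(eL _ _ uf') inv.
(* The difference quotient has integral zero, so subtracting it from [g] does not change [L g]. *)
have -> : L g = L (fun x => - s^-1 * f (x + s *: xi x) + (s^-1 * f x + g x)).
  by rewrite (lin (M + B))// (lin (M + B))// Ls; ring.
apply: (@le_trans _ _ (C' * (e / (C' + 1)))); last first.
  by rewrite mulrA ler_pdivrMr// mulrC ler_pM2l//; lra.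
apply: hC' => // x.
(* The quotient equals [g] at an intermediate point; [xiE] turns the direction there into [xi x]. *)
have [c hc fc] := @MVT_line f g x (xi x) s s0 (fun c _ =>
  eq_rect _ (fun w => is_derive (x + c *: xi x) w f _) (dfg _) _ (xiE x c)).
rewrite (_ : _ + _ = g x - g (x + c *: xi x)); last first.
  rewrite -[in RHS](mulKf (lt0r_neq0 s0) (g (x + c *: xi x))) -fc; ring.
have hc1 : 0 <= c <= 1 by case/andP: hc => -> /= /le_trans; apply.
case: (hB x) => [xB|xo]; last first.
  rewrite (g0 (x + c *: xi x)) ?xo// (_ : g x = 0); last first.
    by apply: g0; have := xo 0; rewrite scale0r addr0; apply; rewrite lexx ler01.
  by rewrite subrr normr0 divr_ge0// ltW.
apply/ltW/hr; rewrite opprD addrA subrr add0r normrN normrZ.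
case/andP: hc => c0 cs; rewrite ger0_norm//; apply: le_lt_trans sB.
by apply: ler_pM.
Qed.

(** Compactness of [K] gives one radius of [h] for which [f (x + h) - f x] is small at every [x] in
    [K]. A pair of points meeting [K] is covered by symmetry, and off [K] both values vanish. *)
Lemma compact_ucsupp (K : set V) (f : V -> R) : compact K -> continuous f ->
  (forall x, ~ K x -> f x = 0) -> exists M0, forall M, M0 <= M -> ucsupp M f.
Proof.
move=> cK cf fK; have /compact_bounded [M0 [_ hM0]] := cK.
exists (M0 + 1) => M hM; split; last first.
  move=> x xM; apply: fK => Kx.
  have h : M0 < M by rewrite (lt_le_trans _ hM)// ltrDl.
  by have := hM0 M h x Kx => /=; rewrite leNgt xM.
move=> e e0.
have : \forall h \near (0 : V), K `<=` (fun x => `|f (x + h) - f x| < e).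
  move/compact_near_coveringP: cK; apply => x Kx.
  have c2 : {for (x, 0 : V), continuous (fun y : V * V => f (y.1 + y.2) - f y.1)}.
    apply: continuousB.
      apply: (@continuous_comp _ _ _ (fun y : V * V => y.1 + y.2) f); last exact: cf.
      by apply: cvgD; [exact: cvg_fst|exact: cvg_snd].
    by apply: (@continuous_comp _ _ _ (fun y : V * V => y.1) f); [exact: cvg_fst|exact: cf].
  rewrite /prop_for /continuous_at /= addr0 subrr in c2.
  exact: (@cvgr0_norm_lt _ _ _ _ _ _ c2 e e0).
move=> /nbhs_ballP[r /= r0 hr]; exists r => // x y xy.
have h1 u w : K u -> `|u - w| < r -> `|f w - f u| < e.
  move=> Ku uw; have := hr (w - u); rewrite -ball_normE/= sub0r normrN distrC.
  by move=> /(_ uw _ Ku); rewrite [u + _]addrC subrK.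
have [Kx|Kx] := pselect (K x); first by rewrite distrC; exact: h1.
have [Ky|Ky] := pselect (K y); first by apply: h1; rewrite // distrC.
by rewrite !fK// subrr normr0.
Qed.

End Line.

(** * Differential calculus *)

Section Smooth.
Variables (R : realType) (V : normedModType R).
Implicit Types (U : set V) (f g : V -> R).

Lemma smooth_differentiable U f x : smooth_on U f -> U x -> differentiable f x.
Proof. by move=> /(_ 1%N)[h _]; exact: h. Qed.

Lemma smooth_derive U f v : smooth_on U f -> smooth_on U ('D_v f).
Proof. by move=> fs k; have [_] := fs k.+1; exact. Qed.

Lemma smooth_continuous U f x : smooth_on U f -> U x -> {for x, continuous f}.
Proof. by move=> fs Ux; exact: (fs 0%N x Ux). Qed.

Lemma near_parallelogram (P : V -> Prop) x v w : (\forall y \near x, P y) ->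
  exists2 h : R, 0 < h & forall a b, 0 <= a <= h -> 0 <= b <= h ->
    P (x + a *: v + b *: w).
Proof.
move=> /nbhs_ballP[r /= r0 hr].
have S0 : 0 < `|v| + `|w| + 1 by rewrite ltr_wpDl// addr_ge0.
exists (r / (`|v| + `|w| + 1) / 2); first by rewrite !divr_gt0.
move=> a b /andP[a0 ah] /andP[b0 bh]; apply: hr; rewrite -ball_normE/= -addrA opprD addrA subrr.
rewrite add0r normrN; apply: (le_lt_trans (ler_normD _ _)).
rewrite !normrZ !ger0_norm//.
set q := r / _ in ah bh.
have q0 : 0 < q by rewrite divr_gt0.
have -> : r = q * (`|v| + `|w| + 1) by rewrite /q divfK// lt0r_neq0.
have := normr_ge0 v; have := normr_ge0 w; nra.
Qed.

Lemma is_derive_translate f x v k df :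
  is_derive (x + k) v f df -> is_derive x v (fun y => f (y + k)) df.
Proof.
have E : (fun h : R => h^-1 *: ((f \o shift (x + k)) (h *: v) - f (x + k)))
  = (fun h : R => h^-1 *: (((fun y => f (y + k)) \o shift x) (h *: v) - f (x + k))).
  by apply/funext => h /=; rewrite addrA.
by move=> -[d e]; split; move: d e; rewrite /derivable /derive E.
Qed.

(** The mean value theorem twice: along [v] for the increment of [f] by [h *: w], then along [w] for
    ['D_v f]. *)
Lemma second_difference U f x v w (h : R) : smooth_on U f -> 0 < h ->
  (forall a b, 0 <= a <= h -> 0 <= b <= h -> U (x + a *: v + b *: w)) ->
  exists c c', [/\ 0 <= c <= h, 0 <= c' <= h &
    f (x + h *: v + h *: w) - f (x + h *: v) - (f (x + h *: w) - f x) =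
    h * (h * 'D_w ('D_v f) (x + c *: v + c' *: w))].
Proof.
move=> sf h0 hU.
have hh : 0 <= h <= h by rewrite (ltW h0) lexx.
have h00 : (0 : R) <= 0 <= h by rewrite lexx ltW.
have [|c hc e1] := @MVT_line R V (fun y => f (y + h *: w) - f y)
    (fun y => 'D_v f (y + h *: w) - 'D_v f y) x v h h0.
  move=> c hc; apply: (@is_deriveB _ _ _ (fun y => f (y + h *: w)) f).
    apply: is_derive_translate; apply/derivableP/diff_derivable.
    by apply: (smooth_differentiable sf); exact: hU.
  apply/derivableP/diff_derivable; apply: (smooth_differentiable sf).
  by have := hU c 0 hc h00; rewrite scale0r addr0.
have [|c' hc' e2] := @MVT_line R V ('D_v f) ('D_w ('D_v f)) (x + c *: v) w h h0.
  move=> c' hc'; apply/derivableP/diff_derivable.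
  by apply: (smooth_differentiable (smooth_derive v sf)); exact: hU.
by exists c, c'; split => //; rewrite e1 e2.
Qed.

(** Schwarz's theorem: the second difference is symmetric in [v] and [w], so the two mixed
    derivatives agree at two points of a small parallelogram, and both are continuous at [x]. *)
Lemma derive_symmetric U f x v w : open U -> smooth_on U f -> U x ->
  'D_v ('D_w f) x = 'D_w ('D_v f) x.
Proof.
move=> oU sf Ux; apply/eqP; rewrite -subr_eq0 -normr_le0.
apply/ler_addgt0Pr => e e0; rewrite add0r.
have e2 : 0 < e / 2 by rewrite divr_gt0.
have nU : \forall y \near x, U y by exact: open_nbhs_nbhs.
have n1 : \forall y \near x, `|'D_v ('D_w f) x - 'D_v ('D_w f) y| < e / 2.
  have := smooth_continuous (smooth_derive v (smooth_derive w sf)) Ux.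
  by move=> /cvgrPdist_lt /(_ _ e2).
have n2 : \forall y \near x, `|'D_w ('D_v f) x - 'D_w ('D_v f) y| < e / 2.
  have := smooth_continuous (smooth_derive w (smooth_derive v sf)) Ux.
  by move=> /cvgrPdist_lt /(_ _ e2).
have [h h0 H] := near_parallelogram v w (filterI nU (filterI n1 n2)).
have [|c [c' [hc hc' E1]]] := @second_difference U f x v w h sf h0.
  by move=> a b ha hb; have [] := H a b ha hb.
have [|b [b' [hb hb' E2]]] := @second_difference U f x w v h sf h0.
  by move=> a b ha hb; rewrite addrAC; have [] := H b a hb ha.
have [_ [_ N2]] := H _ _ hc hc'; have [_ [N1 _]] := H _ _ hb' hb.
rewrite addrAC in N1.
have E : 'D_w ('D_v f) (x + c *: v + c' *: w) = 'D_v ('D_w f) (x + b *: w + b' *: v).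
  apply: (mulfI (lt0r_neq0 h0)); apply: (mulfI (lt0r_neq0 h0)).
  rewrite [x + h *: w + h *: v]addrAC in E2.
  apply: (etrans (esym E1)); apply: etrans E2.
  have swap (s1 s2 s3 s4 : R) : s1 - s2 - (s3 - s4) = s1 - s3 - (s2 - s4) by ring.
  exact: swap.
rewrite E in N2.
rewrite -(subrKA ('D_v ('D_w f) (x + b *: w + b' *: v))).
rewrite distrC in N2.
apply: (le_trans (ler_normD _ _)); rewrite [leRHS]splitr.
exact: (lerD (ltW N1) (ltW N2)).
Qed.

(** The class in which the weighted field lives: [|u| ^ p] with real [p >= 2] is in general not
    smooth at zeros of [u]. *)
Definition C1_on U f := forall x, U x ->
  differentiable f x /\ forall v, {for x, continuous ('D_v f)}.

Lemma near_eq_continuous f g x : (\forall y \near x, f y = g y) ->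
  {for x, continuous f} -> {for x, continuous g}.
Proof.
move=> fg cf; have e := nbhs_singleton fg.
rewrite /prop_for /continuous_at -e.
by apply: cvg_trans cf; exact: near_eq_cvg.
Qed.

Lemma smooth_C1 U f : smooth_on U f -> C1_on U f.
Proof.
move=> sf x Ux; split; first exact: smooth_differentiable sf Ux.
by move=> v; exact: smooth_continuous (smooth_derive v sf) Ux.
Qed.

Lemma C1_continuous U f x : C1_on U f -> U x -> {for x, continuous f}.
Proof. by move=> fC Ux; apply/differentiable_continuous/(fC x Ux).1. Qed.

Lemma C1_is_derive U f x v : C1_on U f -> U x -> is_derive x v f ('D_v f x).
Proof. by move=> fC Ux; apply/derivableP/diff_derivable/(fC x Ux).1. Qed.

Lemma C1_cst U (c : R) : C1_on U (fun _ => c).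
Proof.
move=> x Ux; split; first exact: differentiable_cst.
move=> v; rewrite (_ : 'D_v _ = cst 0); first exact: cst_continuous.
by apply/funext => y; exact: derive_cst.
Qed.

Lemma C1_add U f g : open U -> C1_on U f -> C1_on U g -> C1_on U (fun x => f x + g x).
Proof.
move=> oU fC gC x Ux; split.
  by apply: differentiableD; [exact: (fC _ Ux).1|exact: (gC _ Ux).1].
move=> v; apply: (@near_eq_continuous (fun y => 'D_v f y + 'D_v g y)).
  apply: filterS (open_nbhs_nbhs (conj oU Ux)) => y Uy.
  apply/esym; apply: (@deriveD _ _ _ f g); apply: diff_derivable.
    exact: (fC _ Uy).1.
  exact: (gC _ Uy).1.
by apply: continuousD; [exact: (fC _ Ux).2|exact: (gC _ Ux).2].
Qed.

Lemma C1_mul U f g : open U -> C1_on U f -> C1_on U g -> C1_on U (fun x => f x * g x).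
Proof.
move=> oU fC gC x Ux; split.
  by apply: differentiableM; [exact: (fC _ Ux).1|exact: (gC _ Ux).1].
move=> v; apply: (@near_eq_continuous (fun y => f y * 'D_v g y + g y * 'D_v f y)).
  apply: filterS (open_nbhs_nbhs (conj oU Ux)) => y Uy; apply/esym.
  by apply: (@deriveM _ _ f g); apply: diff_derivable; [exact: (fC _ Uy).1|exact: (gC _ Uy).1].
apply: continuousD; apply: continuousM.
- exact: C1_continuous fC Ux.
- exact: (gC _ Ux).2.
- exact: C1_continuous gC Ux.
- exact: (fC _ Ux).2.
Qed.

Lemma continuous_bigsum (I : Type) (r : seq I) (F : I -> V -> R) (x : V) : (forall i, {for x, continuous (F i)}) ->
  {for x, continuous (fun y => \sum_(i <- r) F i y)}.
Proof.
move=> cF; elim: r => [|i r IH].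
  have -> : (fun y => \sum_(i <- [::]) F i y) = (fun=> 0).
    by apply/funext => y; rewrite big_nil.
  exact: cst_continuous.
have -> : (fun y => \sum_(k <- i :: r) F k y)
    = (fun y => F i y + \sum_(k <- r) F k y).
  by apply/funext => y; rewrite big_cons.
exact: continuousD.
Qed.

Lemma C1_sum U (I : Type) (r : seq I) (F : I -> V -> R) : open U ->
  (forall i, C1_on U (F i)) -> C1_on U (fun x => \sum_(i <- r) F i x).
Proof.
move=> oU FC; elim: r => [|i r IH].
  by under eq_fun do rewrite big_nil; exact: C1_cst.
by under eq_fun do rewrite big_cons; exact: C1_add.
Qed.

Lemma C1_comp U f (g dg : R -> R) : open U -> C1_on U f ->
  (forall x, U x -> is_derive (f x) (1 : R) g (dg (f x))) ->
  (forall x, U x -> {for f x, continuous dg}) -> C1_on U (fun x => g (f x)).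
Proof.
move=> oU fC hg cdg x Ux; split.
  apply: (@differentiable_comp _ _ _ _ f g); first exact: (fC _ Ux).1.
  by apply/derivable1_diffP; have [] := hg _ Ux.
move=> v; apply: (@near_eq_continuous (fun y => dg (f y) * 'D_v f y)).
  apply: filterS (open_nbhs_nbhs (conj oU Ux)) => y Uy; apply/esym.
  by have [_] := is_derive_comp1 (C1_is_derive v fC Uy) (hg _ Uy).
apply: continuousM; last exact: (fC _ Ux).2.
by apply: (@continuous_comp _ _ _ f dg); [exact: C1_continuous fC Ux|exact: cdg].
Qed.

(** For nonzero [h] the difference quotient is constantly [f v]. *)
Lemma is_derive_scalar_linear f : (forall (h : R) v x, f (h *: v + x) = h * f v + f x) ->
  forall x v, is_derive x v f (f v).
Proof.
move=> lf x v.
have lim0 : (fun h : R => h^-1 *: ((f \o shift x) (h *: v) - f x)) @ 0^' --> f v.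
  apply: (@cvg_trans _ ((fun _ : R => f v) @ 0^')); last exact: cvg_cst.
  apply: near_eq_cvg; apply: filterS (nbhs_dnbhs_neq (0 : R)) => h h0.
  by rewrite /= lf addrK [RHS]mulKf.
by split; [exact: cvgP lim0|exact: cvg_lim lim0].
Qed.

Lemma is_derive_mul f g x v df dg : is_derive x v f df -> is_derive x v g dg ->
  is_derive x v (fun y => f y * g y) (df * g x + f x * dg).
Proof.
move=> hf hg; have := @is_deriveM _ _ f g x v _ _ hf hg.
by rewrite addrC [g x *: _]mulrC.
Qed.

Lemma is_derive_add f g x v df dg : is_derive x v f df -> is_derive x v g dg ->
  is_derive x v (fun y => f y + g y) (df + dg).
Proof. by move=> hf hg; exact: @is_deriveD _ _ _ f g x v _ _ hf hg. Qed.

Lemma is_derive_scale f (c : R) x v df : is_derive x v f df ->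
  is_derive x v (fun y => c * f y) (c * df).
Proof. by move=> hf; exact: @is_deriveZ _ _ _ f c x v _ hf. Qed.

Lemma is_derive_bigsum (I : Type) (r : seq I) (F : I -> V -> R) (dF : I -> R) x v :
  (forall i, is_derive x v (F i) (dF i)) ->
  is_derive x v (fun y => \sum_(i <- r) F i y) (\sum_(i <- r) dF i).
Proof.
move=> hF; elim: r => [|i r IH].
  by under eq_fun do rewrite big_nil; rewrite big_nil; exact: is_derive_cst.
by under eq_fun do rewrite big_cons; rewrite big_cons; exact: is_derive_add.
Qed.

Lemma is_derive_powR_comp f (r : R) x v df : 0 < f x -> is_derive x v f df ->
  is_derive x v (fun y => f y `^ r) (r * f x `^ (r - 1) * df).
Proof. by move=> fx hf; exact: is_derive_comp1 hf (is_derive1_powR r fx). Qed.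

Lemma C1_powR U f (r : R) : open U -> C1_on U f -> (forall x, U x -> 0 < f x) ->
  C1_on U (fun x => f x `^ r).
Proof.
move=> oU fC f0; apply: (@C1_comp U f (fun y => y `^ r) (fun y => r * y `^ (r - 1))) => //.
  by move=> x Ux; exact: is_derive1_powR (f0 x Ux).
move=> x Ux; apply: continuousM; first exact: cvg_cst.
by apply/differentiable_continuous/derivable1_diffP; have [] := is_derive1_powR (r - 1) (f0 x Ux).
Qed.

End Smooth.

(** * Real powers of the absolute value *)

Section PowerDerivative.
Variable R : realType.

Lemma norm_powRB1 (p s : R) : 2 <= p -> `|s * `|s| `^ (p - 2)| = `|s| `^ (p - 1).
Proof.
move=> p2; rewrite normrM [X in _ * X]ger0_norm ?powR_ge0//.
by rewrite (_ : p - 2 = p - 1 - 1) ?mulr_powRB1//; lra.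
Qed.

Lemma powR_le_id (q s : R) : 1 <= q -> `|s| <= 1 -> `|s| `^ q <= `|s|.
Proof.
move=> q1 s1; have [->|s0] := eqVneq s 0.
  by rewrite normr0 powR0// gt_eqF//; lra.
by apply: ge1r_powR => //; rewrite normr_gt0 s0.
Qed.

Lemma continuous_powR (r a : R) : 0 < a -> {for a, continuous (fun x : R => x `^ r)}.
Proof.
move=> a0; apply/differentiable_continuous/derivable1_diffP.
by have [] := is_derive1_powR r a0.
Qed.

(** At 0 the modulus is [|s| ^ (p - 1)], which is at most [|s|] near 0 because [p - 1 >= 1]. *)
Lemma continuous_norm_powR (p : R) : 2 <= p ->
  continuous (fun s : R => s * `|s| `^ (p - 2)).
Proof.
move=> p2 s; have [->|s0] := eqVneq s 0.
  rewrite /continuous_at mul0r; apply/cvgrPdist_le => e e0.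
  have m0 : 0 < Num.min 1 e by rewrite lt_min ltr01.
  have := nbhs0_le (V := R) m0; apply: filterS => h.
  rewrite le_min => /andP[h1 he]; rewrite sub0r normrN norm_powRB1//.
  by apply: le_trans he; apply: powR_le_id => //; lra.
apply: (@continuousM _ R (fun x : R => x) (fun x : R => `|x| `^ (p - 2)) s).
  exact: cvg_id.
apply: (@continuous_comp _ _ _ (fun s : R => `|s|) (fun x : R => x `^ (p - 2))).
  exact: norm_continuous.
by apply: continuous_powR; rewrite normr_gt0.
Qed.

(** Away from 0 the absolute value is locally [x] or [- x]; at 0 the difference quotient has modulus
    [|h| ^ (p - 1) <= |h|]. *)
Lemma is_derive_norm_powR (p s : R) : 2 <= p ->
  is_derive s (1 : R) (fun x : R => `|x| `^ p) (p * (s * `|s| `^ (p - 2))).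
Proof.
move=> p2.
have pE (x : R) : 0 < x -> x `^ (p - 1) = x * x `^ (p - 2).
  move=> x0; rewrite (_ : p - 2 = p - 1 - 1); last by ring.
  by rewrite mulr_powRB1// ?ltW//; lra.
have [s0|s0|->] := ltgtP s 0.
- have d1 : is_derive (- s) (1 : R) (fun x : R => x `^ p) (p * (- s) `^ (p - 1)).
    by apply: is_derive1_powR; rewrite oppr_gt0.
  have d2 : is_derive s (1 : R) (fun x : R => - x) (- 1 : R) by exact: is_deriveN.
  have := is_derive1_comp d1 d2.
  rewrite (_ : _ * -1 = p * (s * `|s| `^ (p - 2))); last first.
    by rewrite pE ?oppr_gt0// ltr0_norm//; ring.
  apply: near_eq_is_derive; near=> y => /=.
  by rewrite ltr0_norm//; near: y; exact: lt_nbhsl.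
- have d1 : is_derive s (1 : R) (fun x : R => x `^ p) (p * s `^ (p - 1)).
    exact: is_derive1_powR.
  move: d1; rewrite pE// gtr0_norm//.
  apply: near_eq_is_derive; near=> y => /=.
  by rewrite gtr0_norm//; near: y; exact: lt_nbhsr.
- rewrite mul0r mulr0.
  have lim0 : (fun h : R => h^-1 *: (((fun x : R => `|x| `^ p) \o shift 0) (h *: (1 : R))
      - `|0 : R| `^ p)) @ 0^' --> (0 : R).
    apply/cvgrPdist_le => e e0.
    have m0 : 0 < Num.min 1 e by rewrite lt_min ltr01.
    apply: filterS2 (nbhs_dnbhs_neq (0 : R)) (dnbhs0_le (V := R) m0) => h h0.
    rewrite le_min => /andP[h1 he].
    rewrite sub0r normrN /= normr0 powR0; last by rewrite gt_eqF//; lra.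
    rewrite subr0 addr0 (_ : h *: (1 : R) = h); last exact: mulr1.
    rewrite normrZ normfV [X in _ * X]ger0_norm ?powR_ge0//.
    rewrite -mulr_powRB1//; last by lra.
    rewrite mulKf ?normr_eq0//; apply: le_trans he.
    by apply: powR_le_id => //; lra.
  by split; [apply/cvg_ex; exists 0|exact: cvg_lim lim0].
Unshelve. all: by end_near. Qed.

(* Tangent-line inequality for [x ^ p], read off Young's inequality. *)
Lemma powR_tangent (p a b : R) : 2 <= p -> 0 <= a -> 0 <= b ->
  p * (a `^ (p - 1) * b) <= (p - 1) * a `^ p + b `^ p.
Proof.
move=> p2 a0 b0.
have p0 : 0 < p by lra.
have q0 : 0 < p / (p - 1) by rewrite divr_gt0//; lra.
have p1 : p - 1 != 0 by rewrite gt_eqF//; lra.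
(* The exponents [p / (p - 1)] and [p] are conjugate, and the first one turns [a ^ (p - 1)] into
   [a ^ p]. *)
have := @conjugate_powR R (a `^ (p - 1)) b (p / (p - 1)) p (powR_ge0 _ _) b0 q0 p0.
rewrite -powRrM mulrCA mulfV// mulr1.
rewrite (_ : (p / (p - 1))^-1 + p^-1 = 1); last by field; rewrite p1 gt_eqF.
move=> /(_ erefl) H.
rewrite -ler_pdivlMl//; apply: le_trans H _.
rewrite le_eqVlt; apply/orP; left; apply/eqP; field.
by rewrite p1 gt_eqF.
Qed.

End PowerDerivative.

(** * Horizontal fields *)

Section Symplectic.
Variables (R : realType) (n : nat).

(** The standard symplectic matrix, with blocks [[[0, 1], [-1, 0]]]; the perpendicular gradient is
    [- J] applied to the horizontal gradient. *)
Definition Jmx (a b : 'I_(2 * n)) : R :=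
  if ~~ odd a && (b == a.+1 :> nat) then 1
  else if odd a && (b.+1 == a :> nat) then -1 else 0.

Lemma BH_Jmx a b : BH R n a b = 4 * Jmx a b.
Proof. by rewrite mxE /Jmx; case: ifP => _; [|case: ifP => _]; ring. Qed.

Lemma Jmx_antisym a b : Jmx b a = - Jmx a b.
Proof.
rewrite /Jmx.
have -> : ~~ odd b && (a == b.+1 :> nat) = odd a && (b.+1 == a :> nat) by lia.
have -> : odd b && (a.+1 == b :> nat) = ~~ odd a && (b == a.+1 :> nat) by lia.
by case: (odd a) => /=; case: ifP => _; rewrite ?oppr0 ?opprK.
Qed.

(** The involution exchanging [2i] and [2i + 1]: the row of the only nonzero entry of [Jmx] in
    column [b]. *)
Definition partner_nat (b : nat) : nat := if odd b then b.-1 else b.+1.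

Lemma partner_proof (b : 'I_(2 * n)) : (partner_nat b < 2 * n)%N.
Proof.
rewrite /partner_nat; move: (ltn_ord b); case: ifP => ob bn; first by lia.
by lia.
Qed.

Definition partner b := Ordinal (partner_proof b).

Lemma partner_inj : injective partner.
Proof.
move=> b c /(congr1 val) /=; rewrite /partner_nat => h; apply: val_inj => /=.
by move: h; case: ifP => ob; case: ifP => oc; lia.
Qed.

Lemma JmxE a b : Jmx a b = (if odd b then 1 else -1) * (a == partner b)%:R.
Proof.
rewrite /Jmx -(inj_eq val_inj) /= /partner_nat.
have [ob|ob] := boolP (odd b).
  have -> : ~~ odd a && (b == a.+1 :> nat) = (a == b.-1 :> nat) by lia.
  have -> : odd a && (b.+1 == a :> nat) = false by lia.
  by case: eqP => _; rewrite ?mulr1 ?mulr0.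
have -> : ~~ odd a && (b == a.+1 :> nat) = false by lia.
have -> : odd a && (b.+1 == a :> nat) = (a == b.+1 :> nat) by lia.
by case: eqP => _; rewrite ?mulr1 ?mulr0.
Qed.

(** [J] is a signed permutation matrix, so its columns are orthonormal. *)
Lemma sum_JmxJmx b c : \sum_a Jmx a b * Jmx a c = (b == c)%:R.
Proof.
rewrite (bigD1 (partner b))//= big1 ?addr0.
  rewrite !JmxE eqxx mulr1 (inj_eq partner_inj).
  by case: eqVneq => [<-|_]; [case: ifP => _; ring|rewrite !mulr0].
by move=> a ab; rewrite !JmxE (negbTE ab) mulr0 mul0r.
Qed.

(** An antisymmetric matrix contracted with a symmetric one; the source of all orthogonality
    relations below. *)
Lemma sum_Jmx_sym (S : 'I_(2 * n) -> 'I_(2 * n) -> R) :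
  (forall a b, S a b = S b a) -> \sum_a \sum_b Jmx a b * S a b = 0.
Proof.
move=> Ssym; set s := LHS; suff : s = - s by lra.
rewrite {1}/s exchange_big/= -sumrN; apply: eq_bigr => b _.
by rewrite -sumrN; apply: eq_bigr => a _; rewrite Jmx_antisym Ssym mulNr.
Qed.

End Symplectic.

Section Horizontal.
Variables (R : realType) (n N : nat).
Notation G := (GPt R n N).
Implicit Types (f g : G -> R) (j : 'I_N) (a b : 'I_(2 * n)).

(** Fixed directions: [smooth_on] and [derive_symmetric] concern constant vectors, whereas [Xdir]
    varies with the point. *)
Definition ez j a : G := (delta_mx j a, 0).
Definition et j : G := (0, delta_mx 0 j).
Definition tcoef j a (z : 'M[R]_(N, 2 * n)) : R := 2^-1 * \sum_b BH R n a b * z j b.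

Lemma XdirE j a (x : G) : Xdir j a x = ez j a + tcoef j a x.1 *: et j.
Proof.
by rewrite /Xdir/ez/et; congr pair; rewrite /= ?scaler0 ?addr0 ?add0r.
Qed.

Lemma tcoefD j a (c : R) z w : tcoef j a (z + c *: w) = tcoef j a z + c * tcoef j a w.
Proof.
rewrite /tcoef [c * _]mulrCA -mulrDr [c * _]mulr_sumr -big_split/=; congr (_ * _).
by apply: eq_bigr => b _; rewrite !mxE; ring.
Qed.

Lemma tcoef_delta j a b : tcoef j a (delta_mx j b) = 2 * Jmx R a b.
Proof.
rewrite /tcoef (bigD1 b)//= [delta_mx _ _ _ _]mxE !eqxx mulr1 big1 ?addr0.
  by rewrite BH_Jmx; field.
by move=> c cb; rewrite [delta_mx _ _ _ _]mxE (negbTE cb) andbF mulr0.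
Qed.

Lemma tcoef_Jmx j a z : tcoef j a z = 2 * \sum_b Jmx R a b * z j b.
Proof.
rewrite /tcoef; under eq_bigr do rewrite BH_Jmx -mulrA.
by rewrite -mulr_sumr mulrA; congr (_ * _); field.
Qed.

Lemma Jmx_diag a : Jmx R a a = 0.
Proof. by have := Jmx_antisym R a a => h; lra. Qed.

Lemma Xf_lin j a f x : differentiable f x ->
  Xf j a f x = 'D_(ez j a) f x + tcoef j a x.1 * 'D_(et j) f x.
Proof. by move=> df; rewrite /Xf XdirE !deriveE// linearD linearZ. Qed.

(** The step changes [z] only in entry [(j, a)], and the coefficient [tcoef j a] does not see that
    entry because [J] has zero diagonal. *)
Lemma Xdir_flow j a (x : G) c : Xdir j a (x + c *: Xdir j a x) = Xdir j a x.
Proof.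
rewrite [LHS]XdirE [RHS]XdirE.
rewrite (_ : (x + c *: Xdir j a x).1 = x.1 + c *: delta_mx j a)//.
by rewrite tcoefD tcoef_delta Jmx_diag !mulr0 addr0.
Qed.

Lemma norm_delta m k (i : 'I_m) (l : 'I_k) : `|delta_mx i l : 'M[R]_(m, k)| <= 1.
Proof.
apply: mx_norm_le => // i' l'; rewrite mxE.
by case: (_ && _); rewrite ?normr1 ?normr0.
Qed.

Definition tcoef_lip a : R := 2^-1 * \sum_b `|BH R n a b|.

Lemma tcoef_lip_ge0 a : 0 <= tcoef_lip a.
Proof. by rewrite mulr_ge0//; apply: sumr_ge0. Qed.

Lemma tcoef_bound j a z : `|tcoef j a z| <= tcoef_lip a * `|z|.
Proof.
rewrite /tcoef normrM /tcoef_lip -mulrA ger0_norm// ler_wpM2l//.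
apply: (le_trans (ler_norm_sum _ _ _)); rewrite mulr_suml.
by apply: ler_sum => b _; rewrite normrM ler_wpM2l// norm_coord_le.
Qed.

Lemma Xdir_lip j a (x y : G) : `|Xdir j a x - Xdir j a y| <= tcoef_lip a * `|x - y|.
Proof.
rewrite !XdirE opprD addrACA subrr add0r -scalerBl.
rewrite prod_normE/= scaler0 normr0 max_r// normrZ.
have -> : tcoef j a x.1 - tcoef j a y.1 = tcoef j a (x.1 - y.1).
  by rewrite -[- y.1]scaleN1r tcoefD mulN1r.
apply: (@le_trans _ _ (tcoef_lip a * `|x.1 - y.1|)).
  apply: le_trans (tcoef_bound j a _); rewrite ler_piMr//.
  exact: norm_delta.
by rewrite ler_wpM2l ?tcoef_lip_ge0// prod_normE le_max lexx.
Qed.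

(** The field depends on [z] alone and grows linearly in it, while its [z] part has norm at most 1.
    Once [|z| > |M| + 1], a step of length [c <= 1] cannot bring [z] back to radius [M]. *)
Lemma Xdir_bound M j a : exists B, forall x : G, `|Xdir j a x| <= B \/
  (forall c, 0 <= c <= 1 -> M < `|x + c *: Xdir j a x|).
Proof.
exists (1 + tcoef_lip a * (`|M| + 1)) => x.
have C0 := tcoef_lip_ge0 a.
have [xM|xM] := leP `|x.1| (`|M| + 1).
  left; rewrite XdirE; apply: (le_trans (ler_normD _ _)); apply: lerD.
    by rewrite prod_normE/= normr0 max_l//; exact: norm_delta.
  rewrite normrZ; apply: (@le_trans _ _ `|tcoef j a x.1|).
    by rewrite ler_piMr// prod_normE/= normr0 max_r//; exact: norm_delta.
  by apply: (le_trans (tcoef_bound _ _ _)); exact: ler_wpM2l.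
right => c /andP[c0 c1].
apply: (@lt_le_trans _ _ `|(x + c *: Xdir j a x).1|); last first.
  by rewrite [leRHS]prod_normE le_max lexx.
rewrite /= -[c *: _]opprK; apply: (lt_le_trans _ (lerB_dist _ _)).
rewrite normrN normrZ ger0_norm//.
have := norm_delta j a; have := ler_norm M; have := normr_ge0 (delta_mx j a : 'M[R]_(N, 2 * n)).
nra.
Qed.

Lemma open_punctured : open (~` [set (0 : G)]).
Proof. by apply/closed_openC/accessible_closed_set1/hausdorff_accessible/norm_hausdorff. Qed.

Variable K : set G.
Hypotheses (cK : compact K) (K0 : K `<=` ~` [set 0]).

Lemma near_notK (x : G) : ~ K x -> \forall y \near x, ~ K y.
Proof.
move=> Kx; have : open (~` K).
  by apply/closed_openC/(compact_closed _ cK)/norm_hausdorff.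
by move=> oK; exact: (open_nbhs_nbhs (conj oK Kx)).
Qed.

(** [K] is closed and misses the origin, so [f] vanishes near 0 and is continuous there too. *)
Lemma punctured_ucsupp f : (forall x, x != 0 -> {for x, continuous f}) ->
  (forall x, ~ K x -> f x = 0) -> exists M0, forall M, M0 <= M -> ucsupp M f.
Proof.
move=> cf fK; apply: (compact_ucsupp cK) => // x.
have [->|] := eqVneq x 0; last exact: cf.
have nK : ~ K 0 by move=> /K0; apply.
apply: (@near_eq_continuous _ _ (fun=> 0)); last exact: cst_continuous.
by apply: filterS (near_notK nK) => y /fK.
Qed.

Lemma Xf_off f j a x : (forall x, ~ K x -> f x = 0) -> ~ K x ->
  is_derive x (Xdir j a x) f 0.
Proof.
move=> fK Kx; have := is_derive_cst (0 : R) x (Xdir j a x).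
apply: near_eq_is_derive.
by apply: filterS (near_notK Kx) => y /fK.
Qed.

Lemma is_derive_coord j a (x v : G) :
  is_derive x v (fun y : G => y.1 j a) (v.1 j a).
Proof.
by apply: (@is_derive_scalar_linear _ _ (fun y : G => y.1 j a)) => h w y; rewrite /= !mxE.
Qed.

Lemma is_derive_coordt j (x v : G) :
  is_derive x v (fun y : G => y.2 0 j) (v.2 0 j).
Proof.
by apply: (@is_derive_scalar_linear _ _ (fun y : G => y.2 0 j)) => h w y; rewrite /= !mxE.
Qed.

Lemma coord_C1 (U : set G) j a : C1_on U (fun x : G => x.1 j a).
Proof.
move=> x _; split.
  apply: (@differentiable_comp _ _ _ _ fst (fun M : 'M[R]_(N, 2 * n) => M j a)).
    by apply: linear_differentiable => y; exact: cvg_fst.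
  exact: differentiable_coord.
move=> v; rewrite (_ : 'D_v _ = cst (v.1 j a)); first exact: cst_continuous.
by apply/funext => y; have [_] := is_derive_coord j a y v.
Qed.

Lemma coordt_C1 (U : set G) j : C1_on U (fun x : G => x.2 0 j).
Proof.
move=> x _; split.
  apply: (@differentiable_comp _ _ _ _ snd (fun M : 'rV[R]_N => M 0 j)).
    by apply: linear_differentiable => y; exact: cvg_snd.
  exact: differentiable_coord.
move=> v; rewrite (_ : 'D_v _ = cst (v.2 0 j)); first exact: cst_continuous.
by apply/funext => y; have [_] := is_derive_coordt j y v.
Qed.

Lemma tcoef_C1 (U : set G) j a : open U -> C1_on U (fun x : G => tcoef j a x.1).
Proof.
move=> oU; rewrite /tcoef; under eq_fun do rewrite mulr_sumr.
apply: C1_sum => // b.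
under eq_fun do rewrite mulrA.
by apply: C1_mul => //; [exact: C1_cst|exact: coord_C1].
Qed.

(** Near [x] the derivative along the varying field is a combination, with linear coefficients, of
    derivatives along fixed directions. *)
Lemma Xf_continuous f j a x : C1_on (~` [set 0]) f -> x != 0 ->
  {for x, continuous (Xf j a f)}.
Proof.
move=> fC x0; have Ux : (~` [set 0]) x by apply/eqP.
apply: (@near_eq_continuous _ _
  (fun y => 'D_(ez j a) f y + tcoef j a y.1 * 'D_(et j) f y)).
  apply: filterS (open_nbhs_nbhs (conj open_punctured Ux)) => y Uy.
  by rewrite Xf_lin//; exact: (fC y Uy).1.
apply: continuousD; first exact: (fC x Ux).2.
apply: continuousM; last exact: (fC x Ux).2.
apply: (@C1_continuous _ _ setT) => //.
exact/tcoef_C1/openT.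
Qed.

Lemma Xf_ucsupp f j a : C1_on (~` [set 0]) f -> (forall x, ~ K x -> f x = 0) ->
  exists M0, forall M, M0 <= M -> ucsupp M (Xf j a f).
Proof.
move=> fC fK; apply: punctured_ucsupp => [x x0|x Kx]; first exact: Xf_continuous.
by have [] := Xf_off j a fK Kx.
Qed.

Lemma intG_Xf_eq0 L f j a : csupp_functional (@intG R n N) L ->
  C1_on (~` [set 0]) f -> (forall x, ~ K x -> f x = 0) -> L (Xf j a f) = 0.
Proof.
move=> gL fC fK.
have [|M1 u1] := punctured_ucsupp _ fK.
  by move=> x /eqP x0; exact: C1_continuous fC x0.
have [M2 u2] := Xf_ucsupp j a fC fK.
have uf : ucsupp (Num.max M1 M2) f by apply: u1; rewrite le_max lexx.
have ug : ucsupp (Num.max M1 M2) (Xf j a f) by apply: u2; rewrite le_max lexx orbT.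
apply: (integral_derive_eq0 gL (@Xdir_flow j a) (@Xdir_lip j a) (Xdir_bound _ j a) _ uf ug).
  (* The flow for time [s] is the shear that moves [t_j] by [s * tcoef j a z]. *)
  move=> s; rewrite -(intG_shear j a s (fun z => s * tcoef j a z) uf).
  congr intG; apply/funext => x; congr (f _)%:E.
  by rewrite [LHS]surjective_pairing /= scalerA.
move=> x; have [Kx|Kx] := pselect (K x).
  apply/derivableP/diff_derivable/(fC x _).1; exact: K0.
by apply: derivableP; have [] := Xf_off j a fK Kx.
Qed.

End Horizontal.

Lemma fst_sum (A B : nmodType) (I : Type) (r : seq I) (F : I -> A * B) :
  (\sum_(i <- r) F i).1 = \sum_(i <- r) (F i).1.
Proof. exact: (big_morph fst (fun _ _ => erefl) erefl). Qed.

Lemma snd_sum (A B : nmodType) (I : Type) (r : seq I) (F : I -> A * B) :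
  (\sum_(i <- r) F i).2 = \sum_(i <- r) (F i).2.
Proof. exact: (big_morph snd (fun _ _ => erefl) erefl). Qed.

(** * Euler's identity and the divergence of the perpendicular gradient *)

Section Divergence.
Variables (R : realType) (n N : nat).
Notation G := (GPt R n N).
Notation U := (~` [set (0 : G)]).
Variable (d : G -> R).
Hypothesis d_hom : forall (g : R) x, 0 < g -> d (dil g x) = g * d x.
Hypothesis d_pos : forall x, x != 0 -> 0 < d x.
Hypothesis d_smooth : smooth_on U d.

Let oU : open U := @open_punctured R n N.

Let d_diff x : U x -> differentiable d x.
Proof. exact: smooth_differentiable. Qed.

(** Differentiate [d (dil s x) = s * d x] at [s = 1], where the dilation curve has velocity
    [(z, 2 t)]. *)
Lemma euler_homogeneous x : U x ->
  (\sum_j \sum_a x.1 j a * 'D_(ez R j a) d x) + 2 * (\sum_j x.2 0 j * 'D_(et R n j) d x) = d x.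
Proof.
move=> Ux.
pose c (s : R) : G := (s *: x.1, (s ^+ 2) *: x.2).
have k1 : differentiable (fun s : R => s) (1 : R) by exact/derivable1_diffP/derivable_id.
have k2 : differentiable (fun s : R => s ^+ 2) (1 : R).
  by exact/derivable1_diffP/exprn_derivable.
have c1 : c 1 = x by rewrite /c expr1n !scale1r -surjective_pairing.
have dc : differentiable c (1 : R).
  by apply: differentiable_pair; exact: differentiableZl.
have D2 : 'D_(1 : R) (fun s : R => s ^+ 2) (1 : R) = 2.
  by rewrite exp_derive expr1 !scaler1.
have D3 : 'D_(1 : R) (fun s : R => s) (1 : R) = 1 by exact: derive_id.
have dc1 : 'd c (1 : R) (1 : R) = (x.1, 2 *: x.2) :> G.
  rewrite diff_pair; [|exact: differentiableZl..].
  rewrite !diffZl//= -!deriveE// D2.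
  by rewrite D3 scale1r.
have dx : differentiable d (c 1) by rewrite c1; exact: d_diff.
have D1 : 'D_(x.1, 2 *: x.2) d x = d x.
  rewrite deriveE; last exact: d_diff.
  rewrite -dc1 -[in 'd d _]c1.
  transitivity ('d (d \o c) (1 : R) (1 : R)); first by rewrite (diff_comp dc dx).
  rewrite -deriveE; last exact: differentiable_comp.
  rewrite (@near_eq_derive _ _ _ (d \o c) (fun s => s * d x)).
    have [_ ->] := @is_derive_mul R R (fun s : R => s) (cst (d x)) (1 : R) (1 : R) 1 0
      (is_derive_id _ _) (is_derive_cst _ _ _).
    by rewrite mul1r mulr0 addr0.
  near=> s; rewrite /= -d_hom//; near: s.
  exact: lt_nbhsr.
rewrite -[RHS]D1 deriveE; last exact: d_diff.
have -> : (x.1, 2 *: x.2) = \sum_j \sum_a x.1 j a *: ez R j a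
    + 2 *: \sum_j x.2 0 j *: et R n j :> G.
  rewrite [RHS]surjective_pairing; congr pair => /=.
    rewrite !fst_sum [X in _ + _ *: X]big1 => [|j _]; last by rewrite /= scaler0.
    rewrite scaler0 addr0 [LHS]matrix_sum_delta; apply: eq_bigr => j _.
    by rewrite fst_sum.
  rewrite !snd_sum big1 ?add0r => [|j _]; last first.
    by rewrite snd_sum big1// => a _ /=; rewrite scaler0.
  congr (_ *: _); exact: row_sum_delta.
rewrite linearD linearZ !linear_sum /=; congr (_ + _ * _).
  apply: eq_bigr => j _; rewrite linear_sum; apply: eq_bigr => a _.
  by rewrite linearZ deriveE//; exact: d_diff.
apply: eq_bigr => j _.
by rewrite linearZ deriveE//; exact: d_diff.
Unshelve. all: by end_near. Qed.

(* The entries of the perpendicular gradient, expanded in Cartesian derivatives so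
   that they can be differentiated once more. *)
Definition perp_coord j a (x : G) : R := - \sum_b Jmx R a b *
  ('D_(ez R j b) d x + tcoef j b x.1 * 'D_(et R n j) d x).

Lemma perp_entry_coord j a x : U x -> perp_entry j d x a = perp_coord j a x.
Proof.
move=> Ux; rewrite /perp_entry /perp_coord -sumrN; apply: eq_bigr => b _.
rewrite -(Xf_lin _ _ (d_diff Ux)).
by rewrite /Jmx; case: ifP => _; [|case: ifP => _]; rewrite ?mul1r ?mulN1r ?opprK ?mul0r ?oppr0.
Qed.

Lemma perp_coord_C1 j a : C1_on U (perp_coord j a).
Proof.
rewrite /perp_coord; under eq_fun do rewrite -mulN1r.
apply: C1_mul => //; first exact: C1_cst.
apply: C1_sum => // b; apply: C1_mul => //; first exact: C1_cst.
apply: C1_add => //; first exact/smooth_C1/smooth_derive.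
apply: C1_mul => //; first exact: tcoef_C1.
exact/smooth_C1/smooth_derive.
Qed.

(** The horizontal gradient is orthogonal to its rotation by [J]; this removes the terms where a
    power of [d] is differentiated along the perpendicular part. *)
Lemma sum_Xf_perp_coord j x : U x -> \sum_a Xf j a d x * perp_coord j a x = 0.
Proof.
move=> Ux; rewrite /perp_coord.
under eq_bigr do rewrite mulrN mulr_sumr.
rewrite sumrN; apply/eqP; rewrite oppr_eq0; apply/eqP.
rewrite -[RHS](@sum_Jmx_sym R n (fun a b => Xf j a d x * Xf j b d x)).
  apply: eq_bigr => a _; apply: eq_bigr => b _.
  by rewrite -(Xf_lin j b (d_diff Ux)) mulrCA.
by move=> a b; rewrite mulrC.
Qed.

Lemma sum_z_tcoef j (z : 'M[R]_(N, 2 * n)) : \sum_a z j a * tcoef j a z = 0.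
Proof.
under eq_bigr do rewrite tcoef_Jmx mulrCA mulr_sumr.
rewrite -mulr_sumr (_ : \sum_a _ = 0) ?mulr0//.
rewrite -[RHS](@sum_Jmx_sym R n (fun a b => z j a * z j b)).
  by apply: eq_bigr => a _; apply: eq_bigr => b _; rewrite mulrCA.
by move=> a b; rewrite mulrC.
Qed.

Lemma sum_Xf_z j x : U x ->
  \sum_a Xf j a d x * x.1 j a = \sum_a x.1 j a * 'D_(ez R j a) d x.
Proof.
move=> Ux.
transitivity (\sum_a x.1 j a * 'D_(ez R j a) d x
    + (\sum_a x.1 j a * tcoef j a x.1) * 'D_(et R n j) d x).
  rewrite [X in _ + X]mulr_suml -big_split/=; apply: eq_bigr => a _.
  by rewrite (Xf_lin j a (d_diff Ux)); ring.
by rewrite sum_z_tcoef mul0r addr0.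
Qed.

(** Here [tcoef] is [2 J z] and the perpendicular gradient is [- J] times the gradient; [J]
    preserves inner products, and [sum_Xf_z] evaluates the result. *)
Lemma sum_tcoef_perp_coord j x : U x ->
  \sum_a tcoef j a x.1 * perp_coord j a x = - 2 * \sum_a x.1 j a * 'D_(ez R j a) d x.
Proof.
move=> Ux; rewrite -sum_Xf_z//.
transitivity (\sum_a \sum_c \sum_b (- 2 * (Jmx R a b * Jmx R a c)) * (x.1 j b * Xf j c d x)).
  apply: eq_bigr => a _; rewrite tcoef_Jmx /perp_coord mulrN -mulNr [LHS]mulr_sumr.
  apply: eq_bigr => c _; rewrite -(Xf_lin _ _ (d_diff Ux)) -mulNr [- 2 * _]mulr_sumr.
  by rewrite mulr_suml; apply: eq_bigr => b _; ring.
rewrite exchange_big/= mulr_sumr; apply: eq_bigr => c _.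
rewrite exchange_big/=.
rewrite (bigD1 c)//= [X in _ + X]big1; last first.
  by move=> b bc; rewrite -mulr_suml -mulr_sumr sum_JmxJmx (negbTE bc) mulr0 mul0r.
by rewrite addr0 -mulr_suml -mulr_sumr sum_JmxJmx eqxx /=; ring.
Qed.

(** The product rule for [X_{j,a}] acting on [perp_coord j a]; only these diagonal terms enter the
    divergence. The factor [2 * Jmx R b a] is the derivative of [tcoef j b]. *)
Definition Dperp_coord j a (x : G) : R := - \sum_b Jmx R a b *
  (('D_(ez R j a) ('D_(ez R j b) d) x + tcoef j a x.1 * 'D_(et R n j) ('D_(ez R j b) d) x)
   + (2 * Jmx R b a * 'D_(et R n j) d x
     + tcoef j b x.1 * ('D_(ez R j a) ('D_(et R n j) d) x
                     + tcoef j a x.1 * 'D_(et R n j) ('D_(et R n j) d) x))).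

Lemma is_derive_tcoef j a b x :
  is_derive x (Xdir j a x) (fun y : G => tcoef j b y.1) (2 * Jmx R b a).
Proof.
rewrite -(tcoef_delta R j b a).
apply: (@is_derive_scalar_linear _ _ (fun y : G => tcoef j b y.1)) => h v y.
by rewrite /= addrC tcoefD addrC.
Qed.

Lemma is_derive_Xdir (f : G -> R) j a x : differentiable f x ->
  is_derive x (Xdir j a x) f ('D_(ez R j a) f x + tcoef j a x.1 * 'D_(et R n j) f x).
Proof. by move=> df; rewrite -Xf_lin//; exact/derivableP/diff_derivable. Qed.

Lemma is_derive_perp_coord j a x : U x -> is_derive x (Xdir j a x) (perp_coord j a) (Dperp_coord j a x).
Proof.
move=> Ux.
have -> : perp_coord j a = (fun y : G => \sum_b Jmx R b a *
    ('D_(ez R j b) d y + tcoef j b y.1 * 'D_(et R n j) d y)).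
  apply/funext => y; rewrite /perp_coord -sumrN; apply: eq_bigr => b _.
  by rewrite [in RHS]Jmx_antisym mulNr.
have sm v : differentiable ('D_v d) x.
  exact: smooth_differentiable (smooth_derive _ d_smooth) Ux.
apply: is_derive_eq.
  apply: is_derive_bigsum => b; apply: is_derive_scale; apply: is_derive_add.
    exact: is_derive_Xdir.
  by apply: is_derive_mul; [exact: is_derive_tcoef|exact: is_derive_Xdir].
by rewrite /Dperp_coord -sumrN; apply: eq_bigr => b _; rewrite -mulNr -Jmx_antisym.
Qed.

(** The second derivatives form a symmetric array [S], which [J] annihilates. What survives is
    [2 J_ab ^ 2] times the [t_j] derivative, and the squared entries of [J] sum to [2n]. *)
Lemma sum_Dperp_coord j x : U x -> \sum_a Dperp_coord j a x = 4 * n%:R * 'D_(et R n j) d x.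
Proof.
move=> Ux; rewrite /Dperp_coord sumrN.
pose S a b := 'D_(ez R j a) ('D_(ez R j b) d) x
  + (tcoef j a x.1 * 'D_(et R n j) ('D_(ez R j b) d) x
     + tcoef j b x.1 * 'D_(et R n j) ('D_(ez R j a) d) x)
  + tcoef j b x.1 * tcoef j a x.1 * 'D_(et R n j) ('D_(et R n j) d) x.
have Ssym a b : S a b = S b a.
  have swap (A B p q r s t : R) : A = B ->
    A + (p + q) + r * s * t = B + (q + p) + s * r * t by move=> ->; ring.
  exact: (swap _ _ _ _ _ _ _ (derive_symmetric (ez R j a) (ez R j b) oU d_smooth Ux)).
transitivity (- \sum_a \sum_b (Jmx R a b * S a b
     + - 2 * 'D_(et R n j) d x * (Jmx R a b * Jmx R a b))).
  congr (- _); apply: eq_bigr => a _; apply: eq_bigr => b _.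
  have expand (J J' A ca cb Ta Ta' Tb TT t : R) : J' = - J -> Ta = Ta' ->
    J * ((A + ca * Tb) + (2 * J' * t + cb * (Ta + ca * TT)))
    = J * (A + (ca * Tb + cb * Ta') + cb * ca * TT) + - 2 * t * (J * J).
    by move=> -> ->; ring.
  exact: (expand _ _ _ _ _ _ _ _ _ _ (Jmx_antisym R a b)
    (derive_symmetric (ez R j a) (et R n j) oU d_smooth Ux)).
under eq_bigr do rewrite big_split/= -mulr_sumr.
rewrite big_split/= sum_Jmx_sym// add0r -mulr_sumr exchange_big/=.
under eq_bigr do rewrite sum_JmxJmx eqxx.
by rewrite sumr_const card_ord natrM; ring.
Qed.

End Divergence.

(** * Hardy inequality *)

Section WeightedField.
Variables (R : realType) (n N : nat).
Notation G := (GPt R n N).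
Notation U := (~` [set (0 : G)]).
Variables (d u : G -> R) (p theta : R).
Hypothesis n_gt0 : (0 < n)%N.
Hypothesis d_hom : forall (g : R) x, 0 < g -> d (dil g x) = g * d x.
Hypothesis d_pos : forall x, x != 0 -> 0 < d x.
Hypothesis d_smooth : smooth_on U d.
Hypothesis u_smooth : smooth_on U u.
Hypothesis p_ge2 : 2 <= p.

Let oU : open U := @open_punctured R n N.
Let dpos x : U x -> 0 < d x. Proof. by move=> /eqP; exact: d_pos. Qed.

(** The entries of [Y]. The inverse of [d] is written as a real power, so that [C1_powR] and
    [is_derive_powR_comp] apply. *)
Definition dZ j a (x : G) : R := n.+1%:R / n%:R * x.1 j a
  + - (p * theta / (2 * n%:R)) * (d x `^ (-1) * (x.2 0 j * perp_coord d j a x)).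

Lemma dZ_C1 j a : C1_on U (dZ j a).
Proof.
apply: C1_add => //.
  by apply: C1_mul => //; [exact: C1_cst|exact: coord_C1].
apply: C1_mul => //; first exact: C1_cst.
apply: C1_mul => //; first by apply: C1_powR => //; exact: smooth_C1.
by apply: C1_mul => //; [exact: coordt_C1|exact: perp_coord_C1].
Qed.

Lemma Zd_dZ j a x : U x -> Zd p theta d x j a = d x `^ (-1) * dZ j a x.
Proof.
move=> Ux; have d0 := dpos Ux.
rewrite /Zd !mxE summxE (bigD1 j)//= big1 ?addr0; last first.
  by move=> i ij; rewrite !mxE eq_sym (negbTE ij) mulr0.
rewrite !mxE eqxx (perp_entry_coord d_smooth)// /dZ powR_inv1 ?ltW//.
by field; rewrite gt_eqF//= pnatr_eq0 -lt0n.
Qed.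

Lemma hdot_Zd x : U x -> hdot (hgrad u x) (Zd p theta d x)
  = d x `^ (-1) * \sum_j \sum_a Xf j a u x * dZ j a x.
Proof.
move=> Ux; rewrite /hdot mulr_sumr; apply: eq_bigr => j _.
rewrite mulr_sumr; apply: eq_bigr => a _.
by rewrite mxE Zd_dZ// mulrCA.
Qed.

Definition hardy_field j a (x : G) : R := `|u x| `^ p * d x `^ (- (p * theta)) * dZ j a x.

Lemma norm_powR_C1 : C1_on U (fun x => `|u x| `^ p).
Proof.
apply: (@C1_comp _ _ U u (fun s => `|s| `^ p) (fun s => p * (s * `|s| `^ (p - 2)))) => //.
- exact: smooth_C1.
- by move=> x _; exact: is_derive_norm_powR.
- by move=> x _; apply: continuousM; [exact: cvg_cst|exact: continuous_norm_powR].
Qed.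

Lemma hardy_field_C1 j a : C1_on U (hardy_field j a).
Proof.
apply: C1_mul => //; last exact: dZ_C1.
apply: C1_mul => //; first exact: norm_powR_C1.
by apply: C1_powR => //; exact: smooth_C1.
Qed.

(** Left in the raw shape produced by the product rule; [sum_Xf_hardy_field] collects the terms. *)
Lemma Xf_hardy_field j a x : U x -> Xf j a (hardy_field j a) x =
  let r := - (p * theta) in let be := - (p * theta / (2 * n%:R)) in
  (p * (u x * `|u x| `^ (p - 2)) * Xf j a u x * d x `^ r
    + `|u x| `^ p * (r * d x `^ (r - 1) * Xf j a d x)) * dZ j a x
  + `|u x| `^ p * d x `^ r *
    (n.+1%:R / n%:R * 1 + be * (-1 * d x `^ (-1 - 1) * Xf j a d x * (x.2 0 j * perp_coord d j a x)
     + d x `^ (-1) * (tcoef j a x.1 * perp_coord d j a x + x.2 0 j * Dperp_coord d j a x))).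
Proof.
move=> Ux /=.
have du : is_derive x (Xdir j a x) u (Xf j a u x).
  exact/derivableP/diff_derivable/(smooth_differentiable u_smooth).
have dd : is_derive x (Xdir j a x) d (Xf j a d x).
  exact/derivableP/diff_derivable/(smooth_differentiable d_smooth).
have dU := is_derive_comp1 du (is_derive_norm_powR (u x) p_ge2).
have dt : is_derive x (Xdir j a x) (fun y : G => y.2 0 j) (tcoef j a x.1).
  by apply: is_derive_eq (is_derive_coordt j x _) _; rewrite /= !mxE !eqxx mulr1.
have dz : is_derive x (Xdir j a x) (fun y : G => y.1 j a) 1.
  by apply: is_derive_eq (is_derive_coord j a x _) _; rewrite /= !mxE !eqxx.
have dY := is_derive_add (is_derive_scale (n.+1%:R / n%:R) dz)
  (is_derive_scale (- (p * theta / (2 * n%:R)))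
    (is_derive_mul (is_derive_powR_comp (-1) (dpos Ux) dd)
       (is_derive_mul dt (is_derive_perp_coord d_smooth j a Ux)))).
have [_ e] := is_derive_mul (is_derive_mul dU
  (is_derive_powR_comp (- (p * theta)) (dpos Ux) dd)) dY.
exact: e.
Qed.

(** The coefficients of [Z_d] make the derivatives of [d] combine as in Euler's identity: with
    [be = r / (2n)], [r * al - 2 * be = r] and [4 * n * be = 2 * r]. The remaining term
    [al * 2n * N] is [Q]. *)
Lemma sum_Xf_hardy_field x : U x -> \sum_j \sum_a Xf j a (hardy_field j a) x =
  p * (u x * `|u x| `^ (p - 2)) * d x `^ (- (p * theta))
    * (\sum_j \sum_a Xf j a u x * dZ j a x)
  + ((Qdim n N)%:R - p * theta) * (`|u x| `^ p * d x `^ (- (p * theta))).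
Proof.
move=> Ux; have d0 := dpos Ux.
set r := - (p * theta); set Up := `|u x| `^ p; set ph := d x `^ r.
set Ps := u x * _; pose de := (d x)^-1.
pose al : R := n.+1%:R / n%:R; pose be := - (p * theta / (2 * n%:R)).
have dn b : b ==> (d x != 0) by rewrite gt_eqF//= implybT.
have E1 : d x `^ (-1) = de by rewrite powR_inv1// ltW.
have E2 : d x `^ (r - 1) = ph * de.
  by rewrite powRB// powRr1// ltW.
have E3 : d x `^ (-1 - 1) = de * de.
  by rewrite powRB// E1 powRr1// ltW.
have rowE j : \sum_a Xf j a (hardy_field j a) x =
    p * Ps * ph * (\sum_a Xf j a u x * dZ j a x)
    + (Up * ph * (r * de * al - 2 * be * de)) * (\sum_a x.1 j a * 'D_(ez R j a) d x)
    + Up * ph * (4 * n%:R * be * de) * (x.2 0 j * 'D_(et R n j) d x)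
    + Up * ph * al * (2 * n)%:R.
  (* The factor [r - 1] joins the derivatives of [d ^ r] and of [d ^ (-1)]; its sum vanishes by
     [sum_Xf_perp_coord]. *)
  transitivity (p * Ps * ph * (\sum_a Xf j a u x * dZ j a x)
    + (Up * ph * r * de * al) * (\sum_a Xf j a d x * x.1 j a)
    + (Up * ph * be * de * de * x.2 0 j * (r - 1)) * (\sum_a Xf j a d x * perp_coord d j a x)
    + Up * ph * be * de * (\sum_a tcoef j a x.1 * perp_coord d j a x)
    + Up * ph * be * de * x.2 0 j * (\sum_a Dperp_coord d j a x)
    + Up * ph * al * \sum_(a < 2 * n) 1).
    rewrite !mulr_sumr -!big_split/=; apply: eq_bigr => a _.
    rewrite Xf_hardy_field//= -/r -/Up -/ph -/Ps E1 E2 E3 /dZ E1 -/al -/be.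
    by ring.
  rewrite (sum_Xf_z d_smooth)// (sum_Xf_perp_coord d_smooth)// (sum_tcoef_perp_coord d_smooth)//.
  by rewrite (sum_Dperp_coord d_smooth)// sumr_const card_ord; ring.
rewrite (eq_bigr _ (fun j _ => rowE j)) !big_split/= -!mulr_sumr.
have := euler_homogeneous d_hom d_smooth Ux.
set E := \sum_j \sum_a _; set T := \sum_j _ => ET.
rewrite sumr_const card_ord -[X in X *+ N]mulr1 -mulrnAr.
rewrite -!addrA; congr (_ + _).
have -> : T = (d x - E) / 2 by rewrite -ET; field.
rewrite /Qdim !natrM natrD /be /al /de /r -natr1.
by field; rewrite pnatr_eq0 -lt0n n_gt0 gt_eqF.
Qed.

(** The constant of the idea is [lam ^ (p - 1) * sg q]: the sign turns [q] into [|q| = lam * p],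
    which matches the term [p * A ^ p] of the tangent-line inequality. *)
Lemma hardy_pointwise x q lam : U x ->
  q = (Qdim n N)%:R - p * theta -> lam = `|q / p| ->
  lam `^ p * (`|u x| `^ p / d x `^ (p * theta))
   <= `|hdot (hgrad u x) (Zd p theta d x)| `^ p / d x `^ (p * (theta - 1))
      + lam `^ (p - 1) * Num.sg q * \sum_j \sum_a Xf j a (hardy_field j a) x.
Proof.
move=> Ux qE lamq; have d0 := dpos Ux.
have dn b : b ==> (d x != 0) by rewrite gt_eqF//= implybT.
have p0 : 0 < p by exact: lt_le_trans p_ge2.
have p1 : 0 < p - 1 by rewrite subr_gt0; apply: lt_le_trans p_ge2; rewrite ltr1n.
have lam0 : 0 <= lam by rewrite lamq.
have lamE : lam * p = `|q|.
  by rewrite lamq normrM normfV (gtr0_norm p0) divfK// gt_eqF.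
rewrite sum_Xf_hardy_field// -qE.
set W := hdot _ _; set S := \sum_j \sum_a _.
have SE : S = d x * W.
  by rewrite /W hdot_Zd// powR_inv1 ?ltW// mulrA divff ?gt_eqF// mul1r.
rewrite SE {S SE}.
set ph := d x `^ (- (p * theta)); set m := `|u x|.
have m0 : 0 <= m by exact: normr_ge0.
set A := lam * (m * d x `^ (- theta)); set B := `|W| * d x `^ (1 - theta).
have A0 : 0 <= A by rewrite !mulr_ge0 ?powR_ge0.
have B0 : 0 <= B by rewrite mulr_ge0 ?powR_ge0.
have BE : `|W| `^ p / d x `^ (p * (theta - 1)) = B `^ p.
  rewrite powRM ?powR_ge0// -powRN; congr (_ * _); rewrite -powRrM.
  by congr (_ `^ _); ring.
have AE : lam `^ p * (m `^ p * ph) = A `^ p.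
  rewrite powRM ?mulr_ge0 ?powR_ge0// powRM ?powR_ge0//; congr (_ * (_ * _)).
  by rewrite -powRrM /ph; congr (_ `^ _); ring.
have lhsE : m `^ p / d x `^ (p * theta) = m `^ p * ph by rewrite /ph powRN.
have ABE : A `^ (p - 1) * B = lam `^ (p - 1) * (m `^ (p - 1) * (ph * (d x * `|W|))).
  rewrite powRM ?mulr_ge0 ?powR_ge0// powRM ?powR_ge0// -powRrM /B.
  have -> : ph * (d x * `|W|) = d x `^ (- theta * (p - 1)) * (`|W| * d x `^ (1 - theta)).
    have e1 : ph * d x = d x `^ (- (p * theta) + 1).
      by rewrite powRD// powRr1// ltW.
    rewrite mulrA e1 [RHS]mulrCA -powRD// mulrC.
    by congr (_ * _ `^ _); ring.
  by rewrite !mulrA.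
rewrite BE lhsE AE.
have T := powR_tangent p_ge2 A0 B0.
suff : p * A `^ p - p * (A `^ (p - 1) * B) <=
   lam `^ (p - 1) * Num.sg q * (p * (u x * m `^ (p - 2)) * ph * (d x * W) + q * (m `^ p * ph)) by lra.
have -> : p * A `^ p = lam `^ (p - 1) * (`|q| * (m `^ p * ph)).
  rewrite -AE -lamE -[in LHS](mulr_powRB1 lam0 p0); ring.
rewrite ABE -mulrA -[p * (_ * _)]mulrCA -mulrBr.
apply: ler_wpM2l; first exact: powR_ge0.
rewrite mulrDr [Num.sg q * (q * _)]mulrA -normrEsg addrC lerD2r.
(* The gradient term has unknown sign, so it is bounded below by minus its modulus, with
   [|sg q| <= 1]. *)
apply: (@le_trans _ _ (- `|Num.sg q * (p * (u x * m `^ (p - 2)) * ph * (d x * W))|)); last first.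
  by rewrite lerNl -normrN; exact: ler_norm.
rewrite lerN2 normrM -[leRHS]mul1r.
apply: ler_pM => //.
  by rewrite normr_sg; case: (q != 0).
rewrite !normrM (gtr0_norm p0) (gtr0_norm d0) (ger0_norm (powR_ge0 (d x) _)).
by rewrite -normrM norm_powRB1// -!mulrA.
Qed.

End WeightedField.

(** * Integration of the pointwise bound *)

Unset Implicit Arguments.
Set Strict Implicit.
Set Printing Implicit Defensive.

Theorem theorem4p2 (R : realType) (n N : nat) (hn : (0 < n)%N) (hN : (0 < N)%N)
  (d : GPt R n N -> R) (p theta : R)
  (hd : hom_norm d) (hds : smooth_on (~` [set 0]) d)
  (hp : 2 <= p) (u : GPt R n N -> R) (hu : Cc_inf (~` [set 0]) u) :
  (intG (fun x => ((`|hdot (hgrad u x) (Zd p theta d x)| `^ p)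
                    / (d x `^ (p * (theta - 1))))%:E)
   >= (`|((Qdim n N)%:R - p * theta) / p| `^ p)%:E
        * intG (fun x => ((`|u x| `^ p) / (d x `^ (p * theta)))%:E))%E.
Proof.
have [_ [_ [d_hom [d_pos _]]]] := hd.
have [u_smooth [K [cK [KU uK]]]] := hu.
have oU := @open_punctured R n N.
(* Because [0 ^ 0 = 1], powers of 0 vanish only for a nonzero exponent. *)
have p_neq0 : p != 0 by rewrite gt_eqF//; lra.
have [L gL] := csupp_functional_intG R n N.
have [eL lin pos _] := gL.
have d_C1 r : C1_on (~` [set 0]) (fun x => d x `^ r).
  by apply: C1_powR => //; [exact: smooth_C1|move=> x /eqP; exact: d_pos].
set A := fun x : GPt R n N => `|u x| `^ p / d x `^ (p * theta).
set B := fun x : GPt R n N => `|hdot (hgrad u x) (Zd p theta d x)| `^ p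
  / d x `^ (p * (theta - 1)).
set lam := `|_ / p|.
have [|x Kx|MA uA] := @punctured_ucsupp R n N K cK KU A.
- move=> x x0; have -> : A = (fun x => `|u x| `^ p * d x `^ (- (p * theta))).
    by apply/funext => y; rewrite /A powRN.
  have Ux : (~` [set 0]) x by exact/eqP.
  apply: continuousM; apply: C1_continuous Ux; last exact: d_C1.
  exact: norm_powR_C1.
- by rewrite /A uK// normr0 powR0// mul0r.
have Xu_off j a x : ~ K x -> Xf j a u x = 0.
  by move=> Kx; have [] := Xf_off cK j a uK Kx.
have [|x Kx|MB uB] := @punctured_ucsupp R n N K cK KU B.
- move=> x x0; have -> : B = (fun x => `|hdot (hgrad u x) (Zd p theta d x)| `^ p
      * d x `^ (- (p * (theta - 1)))).
    by apply/funext => y; rewrite /B powRN.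
  have Ux : (~` [set 0]) x by exact/eqP.
  apply: continuousM; last exact: C1_continuous Ux.
  apply: (@continuous_comp _ _ _ (fun x => hdot (hgrad u x) (Zd p theta d x))
    (fun s : R => `|s| `^ p)); last first.
    by apply/differentiable_continuous/derivable1_diffP; have [] := is_derive_norm_powR
      (hdot (hgrad u x) (Zd p theta d x)) hp.
  (* Off the origin the pairing agrees with an expression in [dZ], whose continuity is known. *)
  apply: (@near_eq_continuous _ _
    (fun y => d y `^ (-1) * \sum_j \sum_a Xf j a u y * dZ d p theta j a y)).
    apply: filterS (open_nbhs_nbhs (conj oU Ux)) => y Uy.
    by rewrite hdot_Zd.
  apply: continuousM; first exact: C1_continuous Ux.
  apply: continuous_bigsum => j; apply: continuous_bigsum => a.
  apply: continuousM; first by apply: Xf_continuous => //; exact: smooth_C1.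
  by apply: C1_continuous Ux; exact: dZ_C1.
- rewrite /B (_ : hdot _ _ = 0) ?normr0 ?powR0 ?mul0r//.
  rewrite /hdot big1// => j _; rewrite big1// => a _.
  by rewrite mxE Xu_off// mul0r.
have wf_off j a x : ~ K x -> hardy_field d u p theta j a x = 0.
  by move=> Kx; rewrite /hardy_field uK// normr0 powR0// !mul0r.
have wfC j a : C1_on (~` [set 0]) (hardy_field d u p theta j a) by exact: hardy_field_C1.
have [[MG uG] LG] : (exists M0, forall M, M0 <= M ->
     ucsupp M (fun x => \sum_j \sum_a Xf j a (hardy_field d u p theta j a) x)) /\
   L (fun x => \sum_j \sum_a Xf j a (hardy_field d u p theta j a) x) = 0.
  apply: (@csupp_functional_sum_eq0 _ _ _ _ _ _
    (fun j x => \sum_a Xf j a (hardy_field d u p theta j a) x) gL) => j.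
  apply: (@csupp_functional_sum_eq0 _ _ _ _ _ _
    (fun a x => Xf j a (hardy_field d u p theta j a) x) gL) => a; split.
    exact: (Xf_ucsupp cK KU j a (wfC j a) (wf_off j a)).
  exact: (intG_Xf_eq0 cK KU j a gL (wfC j a) (wf_off j a)).
set Gs := (fun x => _) in uG LG.
pose M := Num.max MA (Num.max MB MG).
have vA : ucsupp M A by apply: uA; rewrite !le_max lexx.
have vB : ucsupp M B by apply: uB; rewrite !le_max lexx ?orbT.
have vG : ucsupp M Gs by apply: uG; rewrite !le_max lexx ?orbT.
rewrite (eL _ _ vA) (eL _ _ vB) -EFinM lee_fin -subr_ge0.
set q := _ - p * theta in lam *.
set k := lam `^ (p - 1) * Num.sg q.
(* [L Gs = 0], so any multiple of it may be added; the claim becomes positivity of [L] on a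
   pointwise nonnegative function. *)
have -> : L B - lam `^ p * L A = - lam `^ p * L A + (k * L Gs + L B).
  by rewrite LG; ring.
have v1 := ucsupp_lin k vG vB.
rewrite -(lin _ _ _ _ vG vB) -(lin _ _ _ _ vA v1).
apply: (pos M); first exact: ucsupp_lin.
(* At the origin [u] and [Gs] vanish, leaving the nonnegative value of [B]. *)
move=> x; have [->|x0] := eqVneq x 0.
  have K0 : ~ K 0 by move=> /KU; apply.
  rewrite {1}/A uK// normr0 powR0// mul0r mulr0 add0r (_ : Gs 0 = 0).
    by rewrite mulr0 add0r divr_ge0// powR_ge0.
  rewrite /Gs big1// => j _; rewrite big1// => a _.
  by have [] := Xf_off cK j a (wf_off j a) K0.
rewrite mulNr addrC subr_ge0 [leRHS]addrC.
by apply: hardy_pointwise => //; exact/eqP.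
Qed.
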